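(* Let $p>3$, $q>3$ be integers with $(p-2)(q-2)>4$, and let $a_i$ and $b_i$ be the numbers of the vertices of type $A$ (non-roots) and of type $B$ (roots), respectively, on level $i$ of the regular hyperbolic mosaic $\{p,q\}$. Put $c=(p-2)(q-2)-2$, $z_1=\frac{c+\sqrt{c^2-4}}{2}$, $z_2=\frac{c-\sqrt{c^2-4}}{2}$, $$g_{a1}=\frac{a_2-z_2a_1}{z_1(z_1-z_2)},\qquad g_{b1}=\frac{b_2-z_2b_1}{z_1(z_1-z_2)},\qquad L=\frac{g_{b1}}{g_{a1}},\qquad K=\frac{L}{1+L}.$$ Then $$\lim_{i\to\infty}\frac{b_i}{\sum_{j=0}^{i}b_j}=\frac{z_1-1}{z_1},\qquad \lim_{i\to\infty}\frac{b_i}{a_i}=L,\qquad \lim_{i\to\infty}\frac{b_i}{a_i+b_i}=K\qquad (i\ge1).$$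
   Context: Consider the regular planar mosaic with Schläfli symbol $\{p,q\}$ (regular $p$-gonal cells, $q$ of them around each vertex); it is Euclidean if $(p-2)(q-2)=4$ and hyperbolic if $(p-2)(q-2)>4$. Fix a vertex $B_0$ of the mosaic. Belts: belt $0$ is the vertex $B_0$. Belt $1$ consists of the cells having a common point with $B_0$. If belt $i$ is known, belt $i+1$ consists of the cells that have a common point (not necessarily a common vertex) with belt $i$ but have none with belt $i-1$. Levels: level $0$ (layer $0$) is $B_0$; for $i\ge1$, level $i$ (layer $i$) is the outer boundary of belt $i$, and the vertices on level $i$ are the vertices of the mosaic lying on it. Trees: tree graphs are built recursively along the edges of the mosaic. $B_0$ is a root (the main root). From level $i-1$ to level $i$ the maximum number of mosaic edges joining level $i-1$ to level $i$ is used, subject to each vertex on level $i$ being connected to at most one vertex of level $i-1$, and no vertex of level $i-1$ being left as a leaf; edges joining two vertices of the same level are never used. The vertices on level $i$ that are not connected to a vertex of level $i-1$ become roots of new trees. Roots are called vertices of type $B$ and all other vertices are of type $A$. The numbers of the vertices of types $A$ and $B$ on level $i$ are denoted by $a_i$ and $b_i$, respectively. One has $a_0=0$, $b_0=1$, $a_1=q$, $b_1=q(p-3)$. *)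

(* Defs.v *)
From HB Require Import structures.
From mathcomp Require Import all_boot all_order all_algebra finmap.
From mathcomp Require Import all_classical all_reals all_analysis.

Set Implicit Arguments.
Unset Strict Implicit.
Unset Printing Implicit Defensive.

Import Order.TTheory GRing.Theory Num.Theory.
Import numFieldNormedType.Exports.

Local Open Scope classical_set_scope.
Local Open Scope ring_scope.

(* The hyperbolic plane is taken in the hyperboloid model, inside R^3 with the Lorentz form of signature (2,1);
   geodesics are its sections by planes through 0. *)

Definition lor (R : realType) (x y : 'rV[R]_3) : R :=
  x 0 0 * y 0 0 + x 0 1 * y 0 1 - x 0 ord_max * y 0 ord_max.

Definition hyperbolic_plane (R : realType) : set 'rV[R]_3 :=
  [set x | lor x x = -1 /\ 0 < x 0 ord_max].

(* For lor n n > 0: the hyperbolic reflection in the line {x | lor x n = 0}. *)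
Definition line_reflection (R : realType) (n x : 'rV[R]_3) : 'rV[R]_3 :=
  x - (2 * lor x n / lor n n) *: n.

Definition hyp_hull (R : realType) (p : nat) (P : 'I_p -> 'rV[R]_3) :
    set 'rV[R]_3 :=
  [set x | hyperbolic_plane x /\
     exists2 t : 'I_p -> R, (forall k, 0 <= t k) & x = \sum_k t k *: P k].

(* The hyperbolic triangle formed by the centre of a regular p-gon, one of its
   vertices and the midpoint of an adjacent side has a right angle at the
   midpoint and, when the interior angles of the p-gon are 2 pi / q, the angles
   pi / p and pi / q at the other two corners.  Its hypotenuse r, the
   circumradius of the p-gon, satisfies cosh r = cot (pi / p) * cot (pi / q);
   this exceeds 1 exactly when (p - 2) * (q - 2) > 4. *)
Definition cosh_circumradius (R : realType) (p q : nat) : R :=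
  (cos (pi / p%:R) / sin (pi / p%:R)) * (cos (pi / q%:R) / sin (pi / q%:R)).

(* Vertices, in cyclic order, of the regular p-gon with interior angles
   2 pi / q centred at (0, 0, 1). *)
Definition base_polygon (R : realType) (p q : nat) (k : 'I_p) : 'rV[R]_3 :=
  let ch := cosh_circumradius R p q in
  let sh := Num.sqrt (ch ^+ 2 - 1) in
  let theta := 2 * pi * k%:R / p%:R in
  \row_(j < 3) [:: sh * cos theta; sh * sin theta; ch]`_j.

(* The regular mosaic {p,q}: all polygons obtained from the base polygon by
   successive reflections in the sides.  A polygon is given by its vertices in
   cyclic order, so that one cell may occur with several labellings; n is any
   normal vector of the line through P k and the next vertex. *)
Inductive mosaic_polygon (R : realType) (p q : nat) :
    ('I_p -> 'rV[R]_3) -> Prop :=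
| mosaic_base : mosaic_polygon q (@base_polygon R p q)
| mosaic_reflect (P : 'I_p -> 'rV[R]_3) (k : 'I_p) (n : 'rV[R]_3) :
    mosaic_polygon q P ->
    0 < lor n n -> lor (P k) n = 0 -> lor (P (ordS k)) n = 0 ->
    mosaic_polygon q (fun j => line_reflection n (P j)).

Definition mosaic_cell (R : realType) (p q : nat) (C : set 'rV[R]_3) : Prop :=
  exists2 P : 'I_p -> 'rV[R]_3, mosaic_polygon q P & C = hyp_hull P.

Definition mosaic_vertex (R : realType) (p q : nat) (x : 'rV[R]_3) : Prop :=
  exists2 P : 'I_p -> 'rV[R]_3, mosaic_polygon q P & exists k, x = P k.

Definition mosaic_edge (R : realType) (p q : nat) (x y : 'rV[R]_3) : Prop :=
  exists2 P : 'I_p -> 'rV[R]_3, mosaic_polygon q P &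
    exists k, (x = P k /\ y = P (ordS k)) \/ (y = P k /\ x = P (ordS k)).

(* belt i is a family of point sets: the single set {B0} for i = 0, and a
   family of cells for i > 0. *)
Definition meets_belt (R : realType) (F : set (set 'rV[R]_3))
    (C : set 'rV[R]_3) : Prop :=
  exists2 D, F D & C `&` D !=set0.

Fixpoint belt (R : realType) (p q : nat) (B0 : 'rV[R]_3) (i : nat) :
    set (set 'rV[R]_3) :=
  match i with
  | 0 => [set [set B0]]
  | i'.+1 =>
    match i' with
    | 0 => [set C | mosaic_cell p q C /\ C B0]
    | i''.+1 => [set C | [/\ mosaic_cell p q C,
                             meets_belt (belt p q B0 i') C &
                           ~ meets_belt (belt p q B0 i'') C]]
    end
  end.

(* The part of the boundary of belt i that it shares with the cells beyond it,
   that is, with the cells belonging to none of the belts 0, ..., i. *)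
Definition outer_boundary (R : realType) (p q : nat) (B0 : 'rV[R]_3) (i : nat) :
    set 'rV[R]_3 :=
  [set x | (exists2 C, belt p q B0 i C & C x) /\
           (exists D, [/\ mosaic_cell p q D,
                          forall j, (j <= i)%N -> ~ belt p q B0 j D & D x])].

Definition level (R : realType) (p q : nat) (B0 : 'rV[R]_3) (i : nat) :
    set 'rV[R]_3 :=
  if i is 0 then [set B0] else outer_boundary p q B0 i.

Definition level_vertices (R : realType) (p q : nat) (B0 : 'rV[R]_3) (i : nat) :
    set 'rV[R]_3 :=
  [set x | mosaic_vertex p q x /\ level p q B0 i x].

(* E is a set of pairs (x, y), x on level i being the parent of y on level
   i + 1. *)
Definition admissible_edges (R : realType) (p q : nat) (B0 : 'rV[R]_3) (i : nat)
    (E : set ('rV[R]_3 * 'rV[R]_3)) : Prop :=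
  [/\ forall x y, E (x, y) ->
        [/\ level_vertices p q B0 i x, level_vertices p q B0 i.+1 y &
            mosaic_edge p q x y],
      forall x x' y, E (x, y) -> E (x', y) -> x = x' &
      forall x, level_vertices p q B0 i x -> exists y, E (x, y)].

(* T i is the set of the edges of the trees between the levels i and i + 1. *)
Definition tree_system (R : realType) (p q : nat) (B0 : 'rV[R]_3)
    (T : nat -> set ('rV[R]_3 * 'rV[R]_3)) : Prop :=
  forall i, admissible_edges p q B0 i (T i) /\
    forall E, admissible_edges p q B0 i E -> (E #<= T i)%card.

Definition has_parent (R : realType) (T : nat -> set ('rV[R]_3 * 'rV[R]_3))
    (i : nat) (y : 'rV[R]_3) : Prop :=
  if i is i'.+1 then exists x, T i' (x, y) else False.

Definition type_A (R : realType) (p q : nat) (B0 : 'rV[R]_3)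
    (T : nat -> set ('rV[R]_3 * 'rV[R]_3)) (i : nat) : set 'rV[R]_3 :=
  [set y | level_vertices p q B0 i y /\ has_parent T i y].

Definition type_B (R : realType) (p q : nat) (B0 : 'rV[R]_3)
    (T : nat -> set ('rV[R]_3 * 'rV[R]_3)) (i : nat) : set 'rV[R]_3 :=
  [set y | level_vertices p q B0 i y /\ ~ has_parent T i y].

(* fset_set is the empty finite set on an infinite set; the levels of the
   mosaic have finitely many vertices. *)
Definition num_A (R : realType) (p q : nat) (B0 : 'rV[R]_3)
    (T : nat -> set ('rV[R]_3 * 'rV[R]_3)) (i : nat) : nat :=
  #|` fset_set (type_A p q B0 T i)|.

Definition num_B (R : realType) (p q : nat) (B0 : 'rV[R]_3)
    (T : nat -> set ('rV[R]_3 * 'rV[R]_3)) (i : nat) : nat :=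
  #|` fset_set (type_B p q B0 T i)|.

(* Main.v *)
(* The triangle group of {p,q} is generated by the reflections in the sides of
   the triangle with angles pi/2, pi/p, pi/q cut from the base polygon.  Tits'
   argument (an element either lengthens with a generator s, and then maps the
   root of s to a positive root, or shortens, and then to a negative one) shows
   that two words in the reflections which map points of the closed triangle to
   the same point differ, modulo the Coxeter relations, by reflections fixing that
   point.

   On the other hand the levels define an explicit abstract map: a type A
   vertex has q - 3 edges going up and a type B vertex q - 2, and two consecutive
   upward edges are joined on the next level by a row of p - 3 type B vertices
   if they start at the same vertex, of p - 4 otherwise.  The generators act on
   the flags of this map with the relations of the triangle group, and following
   the recursion one assigns an isometry to every flag, equivariantly.  So the
   flags of the map correspond one to one to the triangles; cells with a common
   point have a common vertex, whence belts, levels and trees can be read off the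
   abstract map.

   The numbers of vertices then satisfy a(i+1) = (q-3) a(i) + (q-2) b(i) and
   b(i+1) = (p-3) a(i+1) - a(i) - b(i) for i >= 1; this linear map has trace c and
   determinant 1, so both sequences are combinations of z1^i and z2^i, and the
   term with z1 > 1 dominates. *)

Require Import Defs.
From HB Require Import structures.
From mathcomp Require Import all_boot all_order all_algebra finmap.
From mathcomp Require Import all_classical all_reals all_analysis.
From mathcomp Require Import zify ring lra.

Set Implicit Arguments.
Unset Strict Implicit.
Unset Printing Implicit Defensive.

Import Order.TTheory GRing.Theory Num.Theory.
Import numFieldNormedType.Exports.

Local Open Scope classical_set_scope.
Local Open Scope ring_scope.

(** * Words modulo the Coxeter relations *)

Section CoxeterWords.
Variables (I : eqType) (m : I -> I -> nat).
Implicit Types (i j s t a b : I) (u v w : seq I).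

Fixpoint altw a b k : seq I := if k is k'.+1 then a :: altw b a k' else [::].

Lemma size_altw a b k : size (altw a b k) = k.
Proof. by elim: k a b => //= k IH a b; rewrite IH. Qed.

Lemma altw_cat a b k l :
  altw a b (k + l) = altw a b k ++ (if odd k then altw b a l else altw a b l).
Proof. by elim: k a b => //= k IH a b; rewrite IH; case: (odd k). Qed.

Lemma rcons_altw a b k :
  altw a b k.+1 = rcons (altw a b k) (if odd k then b else a).
Proof. by rewrite -addn1 altw_cat -cats1; case: (odd k). Qed.

Lemma rev_altw a b k :
  rev (altw a b k) = if odd k then altw a b k else altw b a k.
Proof.
elim: k a b => //= k IH a b; rewrite rev_cons IH.
case: ifP => kodd.
  by rewrite -[RHS]/(altw b a k.+1) rcons_altw kodd.
by rewrite -[RHS]/(altw a b k.+1) rcons_altw kodd.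
Qed.

Inductive cox : seq I -> seq I -> Prop :=
| cox_refl w : cox w w
| cox_sym w w' : cox w w' -> cox w' w
| cox_trans w' w w'' : cox w w' -> cox w' w'' -> cox w w''
| cox_cat u u' v v' : cox u u' -> cox v v' -> cox (u ++ v) (u' ++ v')
| cox_rel i j : cox (altw i j (2 * m i j)) [::].

Definition reduced w := forall w', cox w w' -> (size w <= size w')%N.

Hypotheses (m_diag : forall i, m i i = 1%N).
Hypotheses (m_gt0 : forall i j, (0 < m i j)%N).

Lemma cox_sq i : cox [:: i; i] [::].
Proof. by have := cox_rel i i; rewrite m_diag. Qed.

Lemma cox_rcons_sq w i : cox (rcons (rcons w i) i) w.
Proof.
rewrite -!cats1 -catA -[X in cox _ X]cats0.
exact: cox_cat (cox_refl _) (cox_sq i).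
Qed.

Lemma cox_rcons w w' i : cox w w' -> cox (rcons w i) (rcons w' i).
Proof. by move=> h; rewrite -!cats1; apply: cox_cat => //; apply: cox_refl. Qed.

(** All relators have even length. *)
Lemma cox_odd w w' : cox w w' -> odd (size w) = odd (size w').
Proof.
elim=> {w w'} //= [w w' w'' _ -> _ -> //|u u' v v' _ h _ h'|i j].
  by rewrite !size_cat !oddD h h'.
by rewrite size_altw oddM.
Qed.

Lemma cox_revl w : cox (rev w ++ w) [::].
Proof.
elim: w => [|i w IH]; first exact: cox_refl.
rewrite rev_cons -cats1 -catA.
apply: cox_trans IH; apply: cox_cat (cox_refl _) _.
rewrite -[i :: w]/([:: i] ++ w) catA -[X in cox _ X]cat0s.
exact: cox_cat (cox_sq i) (cox_refl _).
Qed.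

Lemma cox_revr w : cox (w ++ rev w) [::].
Proof. by rewrite -{1}[w]revK; apply: cox_revl. Qed.

Lemma cox_catl u v w : cox (u ++ v) w -> cox v (rev u ++ w).
Proof.
move=> h; apply: (@cox_trans (rev u ++ (u ++ v))).
  rewrite catA -{1}[v]cat0s; apply: cox_cat (cox_refl _).
  exact: cox_sym (cox_revl _).
exact: cox_cat (cox_refl _) h.
Qed.

Lemma cox_catr u v w : cox (u ++ v) w -> cox u (w ++ rev v).
Proof.
move=> h; apply: (@cox_trans ((u ++ v) ++ rev v)).
  rewrite -catA -{1}[u]cats0; apply: cox_cat (cox_refl _) _.
  exact: cox_sym (cox_revr _).
exact: cox_cat h (cox_refl _).
Qed.

Lemma exists_reduced w : exists2 w', cox w w' & reduced w'.
Proof.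
elim: {w}(size w).+1 {-2}w (ltnSn (size w)) => // n IH w szw.
case: (pselect (reduced w)) => [red|]; first by exists w => //; apply: cox_refl.
move=> /existsNP[w' /not_implyP[ww']].
move/negP; rewrite -ltnNge => lt; case: (IH w' (leq_trans lt _)) => // w2 h r.
by exists w2 => //; apply: cox_trans h.
Qed.

Lemma reduced_catl u v : reduced (u ++ v) -> reduced u.
Proof.
move=> h u' uu'; have := h _ (cox_cat uu' (cox_refl v)).
by rewrite !size_cat leq_add2r.
Qed.

Lemma reduced_catr u v : reduced (u ++ v) -> reduced v.
Proof.
move=> h v' vv'; have := h _ (cox_cat (cox_refl u) vv').
by rewrite !size_cat leq_add2l.
Qed.

Lemma reduced_cox w w' : cox w w' -> size w = size w' -> reduced w -> reduced w'.
Proof. by move=> h e r v w'v; rewrite -e; apply: r; apply: cox_trans w'v. Qed.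

(** Appending [s] twice gives [v] back, so a word shortening [rcons v s] has at least the length of
    [v] minus one; parity excludes the length of [v] itself. *)
Lemma nonreduced_rcons v s : reduced v -> ~ reduced (rcons v s) ->
  exists2 v', cox v (rcons v' s) & (size v').+1 = size v.
Proof.
move=> redv /existsNP[w' /not_implyP[ww']].
move/negP; rewrite -ltnNge size_rcons ltnS => lt; exists w'.
  apply: cox_trans (cox_sym (cox_rcons_sq v s)) _; exact: cox_rcons.
have := redv _ (cox_trans (cox_sym (cox_rcons_sq v s)) (cox_rcons s ww')).
rewrite size_rcons => le; apply/eqP; rewrite eqn_leq le andbT ltn_neqAle lt andbT.
apply/eqP => e; have := cox_odd ww'; rewrite e size_rcons /=.
by case: odd.
Qed.

(** By the relation of length [2 * m a b], an alternating word with [(m a b).+1] letters equals the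
    reverse of the remaining [(m a b).-1] letters, which is shorter. *)
Lemma reduced_altw_le a b k : reduced (altw a b k) -> (k <= m a b)%N.
Proof.
rewrite leqNgt => red; apply/negP => lt.
have := subnKC lt; move: (k - _)%N => l kE.
move: red; rewrite -kE altw_cat => /reduced_catl red.
have := cox_rel a b.
have -> : (2 * m a b = (m a b).+1 + (m a b).-1)%N by have := m_gt0 a b; lia.
rewrite altw_cat; set r := if _ then _ else _ => /cox_catr /red.
rewrite cat0s size_rev size_altw /r; case: ifP => _; rewrite size_altw; lia.
Qed.

(** Equal neighbours cancel, so a reduced word in two letters alternates; its last letter and its
    length then determine it. *)
Lemma reduced_dihedral s t u : {subset u <= [:: s; t]} -> reduced (rcons u s) ->
  rcons u s = (if odd (size u) then altw t s else altw s t) (size u).+1.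
Proof.
elim: u => //= x u IH sub red.
have redu : reduced (rcons u s) by apply: (@reduced_catr [:: x]).
have subu : {subset u <= [:: s; t]}.
  by move=> y yu; apply: sub; rewrite inE yu orbT.
have := IH subu redu => E; rewrite E.
have xhd y v : rcons u s = y :: v -> x <> y.
  move=> e xy; move: red; rewrite e xy => red.
  have /red : cox (y :: y :: v) v.
    exact: (cox_cat (cox_sq y) (cox_refl v)).
  by rewrite /=; lia.
have := sub x (mem_head _ _); rewrite !inE.
by case: ifP E => _ /= /xhd xN /orP[]/eqP xE; rewrite xE in xN *.
Qed.

(** * Right actions satisfying the Coxeter relations *)

Section Action.
Variables (X : Type) (P : X -> Prop) (f : I -> X -> X).
Hypothesis fP : forall i x, P x -> P (f i x).
Hypothesis f_rel : forall i j x, P x ->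
  foldl (fun y k => f k y) x (altw i j (2 * m i j)) = x.

Lemma foldlP w x : P x -> P (foldl (fun y k => f k y) x w).
Proof. by elim: w x => //= i w IH x Px; apply: IH; apply: fP. Qed.

(** The relations are assumed on [P] only, since the steps of the layered map satisfy them on valid
    flags. *)
Lemma cox_foldl w w' x : cox w w' -> P x ->
  foldl (fun y k => f k y) x w = foldl (fun y k => f k y) x w'.
Proof.
move=> h; elim: h x => {w w'} //=.
- by move=> w w' _ IH x /IH ->.
- by move=> w w' w'' _ IH _ IH' x Px; rewrite IH ?IH'.
- move=> u u' v v' _ IH _ IH' x Px; rewrite !foldl_cat IH // IH' //.
  exact: foldlP.
Qed.
End Action.
End CoxeterWords.

(** * Tits' theorem on the geometric representation *)

Section Tits.
Variables (R : realType) (V : lmodType R) (B : V -> V -> R).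
Variables (I : eqType) (m : I -> I -> nat) (al : I -> V).
Hypotheses (B_sym : forall x y, B x y = B y x).
Hypotheses (B_add : forall x y z, B (x + y) z = B x z + B y z).
Hypotheses (B_scale : forall a x y, B (a *: x) y = a * B x y).
Hypotheses (m_diag : forall i, m i i = 1%N) (m_sym : forall i j, m i j = m j i).
Hypotheses (m_gt1 : forall i j, i != j -> (1 < m i j)%N).
Hypotheses (B_al : forall i j, B (al i) (al j) = - cos (pi / (m i j)%:R)).

Definition srefl i x := x - (2 * B x (al i)) *: al i.

Definition wact (w : seq I) x := foldr srefl x w.

Definition chamber x := forall i, 0 <= B x (al i).

(** Duality with the chamber replaces the usual nonnegative coefficients with respect to the simple
    roots. *)
Definition positive u := forall x, chamber x -> 0 <= B x u.

Lemma B_addr x y z : B x (y + z) = B x y + B x z.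
Proof. by rewrite B_sym B_add !(B_sym x). Qed.
Lemma B_scaler a x y : B x (a *: y) = a * B x y.
Proof. by rewrite B_sym B_scale B_sym. Qed.
Lemma B_opp x y : B (- x) y = - B x y.
Proof. by rewrite -scaleN1r B_scale mulN1r. Qed.
Lemma B_oppr x y : B x (- y) = - B x y.
Proof. by rewrite B_sym B_opp B_sym. Qed.

Lemma al_norm i : B (al i) (al i) = 1.
Proof. by rewrite B_al m_diag divr1 cospi opprK. Qed.

Lemma m_gt0 i j : (0 < m i j)%N.
Proof.
by have [->|/m_gt1/ltnW//] := eqVneq i j; rewrite m_diag.
Qed.

Lemma srefl_al i : srefl i (al i) = - al i.
Proof. by rewrite /srefl al_norm mulr1 scaler_nat mulr2n opprD addrA subrr add0r. Qed.

Lemma srefl_add i x y : srefl i (x + y) = srefl i x + srefl i y.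
Proof. by rewrite /srefl B_add mulrDr scalerDl opprD addrACA. Qed.

Lemma srefl_scale i a x : srefl i (a *: x) = a *: srefl i x.
Proof. by rewrite /srefl B_scale scalerBr scalerA mulrCA. Qed.

Lemma B_srefl i x y : B (srefl i x) (srefl i y) = B x y.
Proof.
rewrite /srefl !(B_add, B_addr, B_opp, B_oppr, B_scale, B_scaler) al_norm.
by rewrite (B_sym (al i) y); ring.
Qed.

Lemma sreflK i : involutive (srefl i).
Proof.
move=> x; rewrite {1}/srefl -[X in B _ X]opprK -srefl_al B_oppr B_srefl mulrN.
by rewrite scaleNr opprK /srefl subrK.
Qed.

Lemma wact_cat u v x : wact (u ++ v) x = wact u (wact v x).
Proof. exact: foldr_cat. Qed.

Lemma wact_rcons u i x : wact (rcons u i) x = wact u (srefl i x).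
Proof. by rewrite -cats1 wact_cat. Qed.

Lemma wact_add w x y : wact w (x + y) = wact w x + wact w y.
Proof. by elim: w => //= i w ->; rewrite srefl_add. Qed.

Lemma wact_scale w a x : wact w (a *: x) = a *: wact w x.
Proof. by elim: w => //= i w ->; rewrite srefl_scale. Qed.

Lemma wact_opp w x : wact w (- x) = - wact w x.
Proof. by rewrite -scaleN1r wact_scale scaleN1r. Qed.

Lemma B_wact w x y : B (wact w x) (wact w y) = B x y.
Proof. by elim: w => //= i w IH; rewrite B_srefl. Qed.

Lemma wact_revK w : cancel (wact w) (wact (rev w)).
Proof.
elim: w => //= i w IH x; rewrite rev_cons wact_rcons sreflK; exact: IH.
Qed.

Lemma wactK w : cancel (wact (rev w)) (wact w).
Proof. by move=> x; rewrite -{1}(revK w) wact_revK. Qed.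

Lemma B_wact_adj w x y : B (wact w x) y = B x (wact (rev w) y).
Proof. by rewrite -{1}(wactK w y) B_wact. Qed.

(** * The dihedral group of two generators *)

Section Dihedral.
Variables (s t : I).
Let th : R := pi / (m s t)%:R.
Hypothesis st : s != t.

Lemma th_bounds : 0 < th <= pi / 2.
Proof.
have h : (2 : R) <= (m s t)%:R by rewrite ler_nat; apply: m_gt1.
have pi0 := pi_gt0 R.
rewrite /th divr_gt0 ?(lt_le_trans _ h) //=.
by rewrite ler_wpM2l ?(ltW pi0) // lef_pV2 ?posrE ?(lt_le_trans _ h).
Qed.

Lemma sin_th_gt0 : 0 < sin th.
Proof.
have /andP[h0 h1] := th_bounds; have := pi_gt0 R => pi0.
by apply: sin_gt0_pi => //; lra.
Qed.

(** On the plane of the two roots the product of the reflections is a rotation by [2 * th]. Each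
    letter changes one coefficient, by sin((k+2) th) = 2 cos(th) sin((k+1) th) - sin(k th). *)
Lemma wact_altw k :
  wact (if odd k then altw t s k else altw s t k) (al s) =
  if odd k
  then (sin (k%:R * th) / sin th) *: al s + (sin (k.+1%:R * th) / sin th) *: al t
  else (sin (k.+1%:R * th) / sin th) *: al s + (sin (k%:R * th) / sin th) *: al t.
Proof.
have s0 : sin th != 0 by rewrite gt_eqF ?sin_th_gt0.
have rec j : 2 * cos th * (sin (j.+1%:R * th) / sin th) - sin (j%:R * th) / sin th
    = sin (j.+2%:R * th) / sin th.
  have -> : j.+2%:R * th = j.+1%:R * th + th by rewrite -(natr1 j.+1); ring.
  have -> : j%:R * th = j.+1%:R * th - th by rewrite -(natr1 j); ring.
  by rewrite sinB sinD; field.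
have stm a b : srefl t (a *: al s + b *: al t) = a *: al s + (2 * cos th * a - b) *: al t.
  rewrite srefl_add !srefl_scale srefl_al /srefl B_al scalerBr scalerN scalerA -addrA.
  by rewrite -opprD -scalerDl -scaleNr; congr (_ + _ *: _); rewrite /th; ring.
have tsm a b : srefl s (a *: al s + b *: al t) = (2 * cos th * b - a) *: al s + b *: al t.
  rewrite srefl_add !srefl_scale srefl_al /srefl B_al m_sym scalerBr scalerN scalerA addrCA addrC.
  by rewrite -opprD -scalerDl -scaleNr; congr (_ *: _ + _); rewrite /th; ring.
elim: k => [|k IH] /=.
  by rewrite !mul0r sin0 mul0r scale0r addr0 mul1r divff // scale1r.
move: IH; case: (odd k) => /= ->; rewrite ?(stm, tsm) rec //.
Qed.

(** At [k = 2 * m s t] the angle [k * th] is a full turn, so the coefficients become 1 and 0. *)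
Lemma wact_dihedral_al : wact (altw s t (2 * m s t)) (al s) = al s.
Proof.
have m0 : (m s t)%:R != 0 :> R by rewrite pnatr_eq0 -lt0n m_gt0.
have mth : (2 * m s t)%:R * th = pi *+ 2.
  by rewrite /th natrM -[RHS]mulr_natl; field.
have s0 : sin th != 0 by rewrite gt_eqF ?sin_th_gt0.
have := wact_altw (2 * m s t); rewrite oddM /= => ->.
rewrite -natr1 mulrDl mth mul1r addrC [_ + th]addrC sinD2pi sin2pi divff //.
by rewrite mul0r scale0r scale1r add0r.
Qed.
End Dihedral.

Lemma wact_altw_span s t k x :
  exists a b, wact (altw s t k) x = x + (a *: al s + b *: al t).
Proof.
elim: k s t => [|k IH] s t /=.
  by exists 0, 0; rewrite !scale0r !addr0.
have [a [b ->]] := IH t s.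
rewrite {1}/srefl; set c := 2 * _.
exists (b - c), a; rewrite -addrA; congr (_ + _).
by rewrite scalerBl -addrA addrC.
Qed.

(** The word fixes both roots and moves [x] by a vector of their span. By invariance of [B] this
    vector is orthogonal to both roots, and their Gram determinant is a nonzero squared sine, so it
    vanishes. *)
Lemma wact_rel s t x : wact (altw s t (2 * m s t)) x = x.
Proof.
have [<-|st] := eqVneq s t; first by rewrite m_diag /= sreflK.
set g := altw s t _.
have gs : wact g (al s) = al s by apply: wact_dihedral_al.
have gt : wact g (al t) = al t.
  have ts : t != s by rewrite eq_sym.
  rewrite -{1}(wact_dihedral_al ts) m_sym /g.
  have -> : altw s t (2 * m s t) = rev (altw t s (2 * m s t)).
    by rewrite rev_altw oddM.
  exact: wact_revK.
have [a [b e]] := wact_altw_span s t (2 * m s t) x; rewrite -/g in e.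
have os := B_wact g x (al s); have ot := B_wact g x (al t).
rewrite gs e B_add in os; rewrite gt e B_add in ot.
have {}os : B (a *: al s + b *: al t) (al s) = 0 by apply: (addrI (B x (al s))); rewrite os addr0.
have {}ot : B (a *: al s + b *: al t) (al t) = 0 by apply: (addrI (B x (al t))); rewrite ot addr0.
move: os ot; rewrite !B_add !B_scale !al_norm !B_al (m_sym t s).
have := sin_th_gt0 st; have := sin2cos2 (pi / (m s t)%:R : R).
set sn := sin _; set c := cos _ => sc sn0 os ot.
have s20 : sn ^+ 2 != 0 by rewrite sqrf_eq0 gt_eqF.
have a0 : a = 0.
  apply: (mulIf s20); rewrite sc mul0r.
  have -> : a * (1 - c ^+ 2) = (a * 1 + b * - c) + c * (a * - c + b * 1) by ring.
  by rewrite os ot mulr0 addr0.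
have b0 : b = 0 by move: ot; rewrite a0; lra.
by rewrite e a0 b0 !scale0r !addr0.
Qed.

Lemma cox_wact w w' x : cox m w w' -> wact w x = wact w' x.
Proof.
move=> h; elim: h x => {w w'} //=.
- by move=> w w' w'' _ IH _ IH' x; rewrite IH.
- by move=> u u' v v' _ IH _ IH' x; rewrite !wact_cat IH' IH.
- by move=> i j x; rewrite wact_rel.
Qed.

Local Notation reduced := (reduced m).
Local Notation cox := (cox m).

Lemma positive_comb a b u v : 0 <= a -> 0 <= b -> positive u -> positive v ->
  positive (a *: u + b *: v).
Proof.
move=> a0 b0 pu pv x cx; rewrite B_addr !B_scaler.
by rewrite addr_ge0 // mulr_ge0 // ?pu ?pv.
Qed.

(* Among all factorisations w = v u with lengths adding up and u in the
   dihedral group of s and the last letter of w, one with v shortest has v s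
   and v t longer than v; then u maps the root of s to a nonnegative
   combination of the roots of s and t, and v is handled by induction. *)
Lemma reduced_positive w s : reduced w -> reduced (rcons w s) -> positive (wact w (al s)).
Proof.
elim: {w}(size w).+1 {-2}w s (ltnSn (size w)) => // n IH w s szw redw redws.
case: (lastP w) szw redw redws => [|w' t] szw redw redws.
  by move=> x; apply.
have st : s != t.
  apply/eqP => e; move: redws => /(_ w'); rewrite e => /(_ (cox_rcons_sq m_diag _ _)).
  by rewrite !size_rcons; lia.
pose Q k := `[< exists v u, [/\ cox (rcons w' t) (v ++ u),
   (size v + size u = size (rcons w' t))%N, {subset u <= [:: s; t]} & size v = k] >].
have exQ : exists k, Q k.
  exists (size w'); apply/asboolP; exists w', [:: t]; split.
  - by rewrite cats1; apply: cox_refl.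
  - by rewrite size_rcons addn1.
  - by move=> y; rewrite !inE => ->; rewrite orbT.
  - by [].
case: (ex_minnP exQ) => k /asboolP[v [u [wvu szvu subu szv]]] kmin.
have {kmin} vmin v' u' : cox (rcons w' t) (v' ++ u') ->
    (size v' + size u' = size (rcons w' t))%N -> {subset u' <= [:: s; t]} ->
    (size v <= size v')%N.
  by move=> *; rewrite szv; apply: kmin; apply/asboolP; exists v', u'.
have szvw : (size v <= size w')%N.
  apply: (vmin _ [:: t]); first by rewrite cats1; apply: cox_refl.
  - by rewrite size_rcons addn1.
  - by move=> y; rewrite !inE => ->; rewrite orbT.
have redvu : reduced (v ++ u).
  by apply: reduced_cox wvu _ redw; rewrite size_cat.
have redv := reduced_catl redvu.
have long r : r \in [:: s; t] -> reduced (rcons v r).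
  move=> rst; apply: contrapT => /(nonreduced_rcons m_diag redv)[v' vv' szv'].
  have := vmin v' (r :: u); rewrite -szv' ltnn => /(_ _ _ _)/negP; apply => //.
  - apply: cox_trans wvu _; rewrite -cat_rcons.
    exact: cox_cat vv' (cox_refl _ _).
  - by rewrite -szvu -szv' /= addnS.
  - by move=> y; rewrite inE => /orP[/eqP->|/subu].
have szvn : (size v < n)%N.
  by move: szw; rewrite size_rcons; lia.
have pos_s : positive (wact v (al s)) by apply: IH => //; apply: long; rewrite !inE eqxx.
have pos_t : positive (wact v (al t)) by apply: IH => //; apply: long; rewrite !inE eqxx orbT.
have redus : reduced (rcons u s).
  apply: (@reduced_catr _ _ v); rewrite -rcons_cat.
  apply: reduced_cox (cox_rcons s wvu) _ redws.
  by rewrite !size_rcons size_cat szvu size_rcons.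
have uE := reduced_dihedral m_diag subu redus.
have ule : (size u < m s t)%N.
  move: redus; rewrite uE; case: ifP => _ /(reduced_altw_le m_diag m_gt0) //.
  by rewrite m_sym.
have {}uE : u = if odd (size u) then altw t s (size u) else altw s t (size u).
  move: uE; case: ifP => o; rewrite rcons_altw o => /rcons_inj[] //.
rewrite (cox_wact _ wvu) wact_cat uE wact_altw //.
have pi0 := pi_gt0 R.
have m0 : (0 : R) < (m s t)%:R by rewrite ltr0n m_gt0.
(* As [size u < m s t], both coefficients involve sines of angles between 0 and [pi]. *)
have sge j : (j <= m s t)%N -> 0 <= sin (j%:R * (pi / (m s t)%:R)) / sin (pi / (m s t)%:R) :> R.
  move=> jm; apply: divr_ge0; last exact: ltW (sin_th_gt0 st).
  apply: sin_ge0_pi; apply/andP; split.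
    by rewrite mulr_ge0 ?divr_ge0 ?(ltW pi0) ?(ltW m0).
  by rewrite mulrCA ler_piMr ?(ltW pi0) // ler_pdivrMr // mul1r ler_nat.
have := sge _ ule; have := sge _ (ltnW ule).
by case: ifP => _ ??; rewrite wact_add !wact_scale; apply: positive_comb.
Qed.

Lemma reduced_rcons_negative w s : reduced (rcons w s) ->
  positive (- wact (rcons w s) (al s)).
Proof.
move=> red; rewrite wact_rcons srefl_al wact_opp opprK.
by apply: reduced_positive => //; apply: (@reduced_catl _ _ _ [:: s]); rewrite cats1.
Qed.

Lemma chamber_fundamental w x : chamber x -> chamber (wact w x) ->
  exists2 w', cox w w' & forall i, i \in w' -> B x (al i) = 0.
Proof.
move=> cx cwx; have [w' ww' red] := exists_reduced m w.
rewrite (cox_wact _ ww') in cwx; suff h : forall i, i \in w' -> B x (al i) = 0.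
  by exists w'.
elim/last_ind: w' {ww'} red cwx => // w' s IH red cwx.
have xs0 : B x (al s) = 0.
  apply/eqP; rewrite eq_le cx andbT.
  have := reduced_rcons_negative red cwx.
  by rewrite B_oppr B_wact oppr_ge0.
have sx : srefl s x = x by rewrite /srefl xs0 mulr0 scale0r subr0.
move=> i; rewrite mem_rcons inE => /orP[/eqP->//|]; apply: IH.
  by apply: (@reduced_catl _ _ _ [:: s]); rewrite cats1.
by move: cwx; rewrite wact_rcons sx.
Qed.

Lemma wact_fix w x : (forall i, i \in w -> B x (al i) = 0) -> wact w x = x.
Proof.
elim: w => //= i w IH h; rewrite IH; last by move=> j jw; rewrite h // inE jw orbT.
by rewrite /srefl h ?mem_head // mulr0 scale0r subr0.
Qed.
End Tits.

(** * The layered map *)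

(* G0, G1 and G2 name the reflections in the sides of the triangle spanned by a
   vertex of the mosaic, the midpoint of an edge at it and the centre of a cell
   at that edge: they move the vertex, the edge and the cell, respectively. *)
Variant gen := G0 | G1 | G2.

Definition gen_eq (a b : gen) : bool :=
  match a, b with G0, G0 | G1, G1 | G2, G2 => true | _, _ => false end.
Lemma gen_eqP : Equality.axiom gen_eq.
Proof. by case; case; constructor. Qed.
HB.instance Definition _ := hasDecEq.Build gen gen_eqP.

Definition triangle_order (p q : nat) (i j : gen) : nat :=
  match i, j with
  | G0, G1 | G1, G0 => p
  | G1, G2 | G2, G1 => q
  | G0, G2 | G2, G0 => 2
  | _, _ => 1
  end.

Section LayeredMap.
Local Open Scope nat_scope.
Variables (p q : nat).
Hypotheses (q_gt3 : 3 < q).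

(* A vertex is coded by the way to it from the root: (m, l) :: u is the l-th
   vertex of the m-th group of children of u. The group consists of the upper
   end of the m-th edge that goes up from u, for l = 0, and of the type B
   vertices that follow it on the level, up to the next type A vertex. *)
Definition vtx : Type := seq (nat * nat).
Implicit Types (u v : vtx).

(** Off the root two of the [q] edges run along the level, and a type A vertex has one more edge, to
    its parent. *)
Definition nup v : nat :=
  match v with [::] => q | (_, 0) :: _ => q - 3 | _ => q - 2 end.

(** The type A vertex at the head of the group is counted with the [p - 3] or [p - 4] type B
    vertices. At the root all pairs of consecutive edges start at the same vertex, including the
    last and the first. *)
Definition glen u (m : nat) : nat :=
  if nilp u || (m.+1 < nup u) then p - 2 else p - 3.

Fixpoint valid v : bool :=
  if v is (m, l) :: u then [&& valid u, m < nup u & l < glen u m] else true.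

(** Levels are cyclic: after the last group of [u] comes the first group of [nxt u]. At the root,
    which [nxt] fixes, this closes level 1. *)
Fixpoint nxt v : vtx :=
  if v is (m, l) :: u then
    if l.+1 < glen u m then (m, l.+1) :: u
    else if m.+1 < nup u then (m.+1, 0) :: u else (0, 0) :: nxt u
  else [::].

Fixpoint prv v : vtx :=
  if v is (m, l) :: u then
    if l is l'.+1 then (m, l') :: u
    else if m is m'.+1 then (m', (glen u m').-1) :: u
    else ((nup (prv u)).-1, (glen (prv u) (nup (prv u)).-1).-1) :: prv u
  else [::].

Lemma nup_gt0 v : 0 < nup v.
Proof. by case: v => [|[m [|l]] v] /=; lia. Qed.

Lemma nup_lt v : v != [::] -> (nup v).+1 < q.
Proof. by case: v => [|[m [|l]] v] //= _; lia. Qed.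

Definition updart u (m : nat) : nat := if nilp u then m else m.+1.

Lemma updart_lt u m : m < nup u -> updart u m < q.
Proof. by case: u => [|[m' [|l]] u] //=; rewrite /updart /=; lia. Qed.

Definition rot (k : nat) : nat := if k.+1 < q then k.+1 else 0.
Definition unrot (k : nat) : nat := if k is k'.+1 then k' else q.-1.

Lemma rot_lt k : rot k < q. Proof. by rewrite /rot; case: ifP => //; lia. Qed.
Lemma unrot_lt k : k < q -> unrot k < q. Proof. by case: k => //=; lia. Qed.
Lemma rotK k : k < q -> unrot (rot k) = k.
Proof. by rewrite /rot; case: ifP => //=; lia. Qed.
Lemma unrotK k : k < q -> rot (unrot k) = k.
Proof. by case: k => [|k] h; rewrite /rot /=; case: ifP => //; lia. Qed.

Lemma iter_rot n k : k < q -> iter n rot k = (k + n) %% q.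
Proof.
move=> kq; elim: n => [|n IH]; first by rewrite addn0 modn_small.
rewrite iterS IH /rot addnS.
have -> : (k + n).+1 %% q = ((k + n) %% q).+1 %% q by rewrite -addn1 -modnDml addn1.
case: ifP => h; first by rewrite [RHS]modn_small.
have -> : ((k + n) %% q).+1 = q by have := ltn_pmod (k + n) (ltnW (ltnW (ltnW q_gt3))); lia.
by rewrite modnn.
Qed.

Lemma iter_rot_q k : k < q -> iter q rot k = k.
Proof. by move=> kq; rewrite iter_rot // modnDr modn_small. Qed.

Hypotheses (p_gt3 : 3 < p).

Lemma glen_gt0 u m : 0 < glen u m.
Proof. by rewrite /glen; case: ifP; lia. Qed.

Lemma size_nxt v : size (nxt v) = size v.
Proof. by elim: v => [|[m l] v IH] //=; do !case: ifP => //=; rewrite IH. Qed.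

Lemma size_prv v : size (prv v) = size v.
Proof. by elim: v => [|[[|m] [|l]] v IH] //=; rewrite IH. Qed.

Lemma valid_nxt v : valid v -> valid (nxt v).
Proof.
elim: v => [|[m l] v IH] //= /and3P[vv mv lv].
case: ifP => h /=; first by rewrite vv mv h.
case: ifP => h' /=; first by rewrite vv h' glen_gt0.
by rewrite IH // nup_gt0 glen_gt0.
Qed.

Lemma valid_prv v : valid v -> valid (prv v).
Proof.
elim: v => [|[[|m] [|l]] v IH] //= /and3P[vv mv lv].
- by rewrite IH //= !ltn_predL nup_gt0 glen_gt0.
- by rewrite vv mv ltnW.
- by rewrite vv (ltnW mv) ltn_predL glen_gt0.
- by rewrite vv mv ltnW.
Qed.

Lemma nxtK v : valid v -> prv (nxt v) = v.
Proof.
elim: v => [|[m l] v IH] //= /and3P[vv mv lv].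
case: ifP => h //=.
have lE : l = (glen v m).-1 by lia.
case: ifP => h' /=; first by rewrite lE.
have mE : m = (nup v).-1 by lia.
by rewrite IH // -mE -lE.
Qed.

Lemma prvK v : valid v -> nxt (prv v) = v.
Proof.
elim: v => [|[[|m] [|l]] v IH] //= /and3P[vv mv lv].
- by rewrite !prednK ?nup_gt0 ?glen_gt0 // !ltnn IH.
- by rewrite lv.
- by rewrite prednK ?glen_gt0 // ltnn mv.
- by rewrite lv.
Qed.

(* The darts at a vertex are numbered in cyclic order: at the root all q of
   them point up; elsewhere 0 points to the previous vertex of the level,
   1, ..., nup v point up, nup v + 1 points to the next vertex of the level, and
   for a vertex with a parent q - 1 points down. *)
Definition edge (d : vtx * nat) : vtx * nat :=
  let: (v, k) := d in
  if v is (m, _) :: u then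
    if k == 0 then (prv v, (nup (prv v)).+1)
    else if k <= nup v then ((k.-1, 0) :: v, q.-1)
    else if k == (nup v).+1 then (nxt v, 0)
    else (u, updart u m)
  else ([:: (k, 0)], q.-1).

Definition vdart (d : vtx * nat) : bool := valid d.1 && (d.2 < q).

Lemma edge_up u m : m < nup u -> edge (u, updart u m) = ((m, 0) :: u, q.-1).
Proof. by case: u => [|[m' l] u] //= h; rewrite h. Qed.

Lemma edge_next v : v != [::] -> edge (v, (nup v).+1) = (nxt v, 0).
Proof. by case: v => [|[m' l] u] //= _; rewrite ltnn eqxx. Qed.

Lemma edge_prev v : v != [::] -> edge (v, 0) = (prv v, (nup (prv v)).+1).
Proof. by case: v => // -[m l] u. Qed.

Lemma edge_down u m : edge ((m, 0) :: u, q.-1) = (u, updart u m).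
Proof.
rewrite /edge ifF; last by lia.
by rewrite ifF /=; [rewrite ifF //; lia | lia].
Qed.

Variant dart_spec : vtx * nat -> Type :=
| DartUp u m of valid u & m < nup u : dart_spec (u, updart u m)
| DartPrev v of valid v & v != [::] : dart_spec (v, 0)
| DartNext v of valid v & v != [::] : dart_spec (v, (nup v).+1)
| DartDown u m of valid u & m < nup u : dart_spec ((m, 0) :: u, q.-1).

Lemma dartP d : vdart d -> dart_spec d.
Proof.
case: d => -[|[m l] u] k; rewrite /vdart /=.
  exact: (@DartUp [::] k isT).
case/andP=> vv kq.
have [->|k0] := eqVneq k 0; first exact: DartPrev.
set v := (m, l) :: u in vv *.
have [kn|nk] := leqP k (nup v).
  have -> : k = updart v k.-1 by rewrite /updart /= prednK // lt0n.
  by apply: DartUp => //; rewrite -ltnS prednK // lt0n.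
have [->|kn] := eqVneq k (nup v).+1; first exact: DartNext.
case/and3P: (vv) => vu mu lu.
case: l @v vv nk kn lu => [|l] v vv nk kn lu; rewrite /= in nk kn.
  have -> : k = q.-1 by lia.
  exact: DartDown.
by exfalso; lia.
Qed.

Lemma edge_valid d : vdart d -> vdart (edge d).
Proof.
move=> vd; case: (dartP vd) => [u m vu mu|v vv v0|v vv v0|u m vu mu].
- by rewrite edge_up // /vdart /= vu mu glen_gt0; lia.
- by rewrite edge_prev // /vdart /= valid_prv // nup_lt // -size_eq0 size_prv size_eq0.
- by rewrite edge_next // /vdart /= valid_nxt //; lia.
- by rewrite edge_down /vdart /= vu updart_lt.
Qed.

Lemma edgeK d : vdart d -> edge (edge d) = d.
Proof.
move=> vd; case: (dartP vd) => [u m vu mu|v vv v0|v vv v0|u m vu mu].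
- by rewrite edge_up // edge_down.
- by rewrite edge_prev // edge_next ?prvK // -size_eq0 size_prv size_eq0.
- by rewrite edge_next // edge_prev ?nxtK // -size_eq0 size_nxt size_eq0.
- by rewrite edge_down edge_up.
Qed.

Definition flag : Type := vtx * nat * bool.
Implicit Types (x : flag).

Definition vflag x : bool := vdart x.1.

(* The flag (v, k, true) lies between the darts k and k + 1 at v, the flag
   (v, k, false) between k - 1 and k. *)
Definition step (g : gen) x : flag :=
  match g with
  | G0 => (edge x.1, ~~ x.2)
  | G1 => (x.1.1, if x.2 then rot x.1.2 else unrot x.1.2, ~~ x.2)
  | G2 => (x.1, ~~ x.2)
  end.

Lemma step_valid g x : vflag x -> vflag (step g x).
Proof.
case: x => -[v k] s; rewrite /vflag; case: g => //=; first exact: edge_valid.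
rewrite /vdart /= => /andP[-> kq]; case: s; first exact: rot_lt.
exact: unrot_lt.
Qed.

Lemma stepK g x : vflag x -> step g (step g x) = x.
Proof.
case: x => d s; rewrite /vflag => vd; case: g; rewrite /step negbK //.
  by rewrite edgeK.
case: d vd => v k /andP[_ /= kq]; case: s => /=; first by rewrite rotK.
by rewrite unrotK.
Qed.

Lemma foldl_altw (i j : gen) n x :
  foldl (fun y g => step g y) x (altw i j (2 * n)) = iter n (step j \o step i) x.
Proof.
elim: n x => [|n IH] x; first by rewrite muln0.
by rewrite mulnS /= -/(altw i j (2 * n)) IH -iterSr.
Qed.

Lemma iter_step_valid i j n x : vflag x -> vflag (iter n (step j \o step i) x).
Proof. by move=> vx; elim: n => //= n IH; do 2!apply: step_valid. Qed.

Lemma iter_step_sym i j n x : vflag x ->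
  iter n (step j \o step i) x = x -> iter n (step i \o step j) x = x.
Proof.
move=> vx e; rewrite -{1}e {e}; elim: n => // k IH.
rewrite [LHS]iterSr [iter k.+1 _ x]iterS /=.
rewrite (stepK j); last by apply: step_valid; apply: iter_step_valid.
by rewrite (stepK i) //; apply: iter_step_valid.
Qed.

Lemma iter_step_conj i j n x : vflag x ->
  iter n (step j \o step i) (step j x) = step j (iter n (step i \o step j) x).
Proof. by move=> vx; elim: n => // n IH; rewrite iterS IH. Qed.

(* phi walks along the boundary of the face to the left of a dart. *)
Definition phi (d : vtx * nat) : vtx * nat := ((edge d).1, unrot (edge d).2).

Lemma phi_up u m : m < nup u -> phi (u, updart u m) = ((m, 0) :: u, q - 2).
Proof. by move=> h; rewrite /phi edge_up //; have -> : q.-1 = (q - 2).+1 by lia. Qed.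

Lemma phi_iter_up u m l : m < nup u -> l < glen u m ->
  iter l.+1 phi (u, updart u m) = ((m, l) :: u, (nup ((m, l) :: u)).+1).
Proof.
move=> mu; elim: l => [|l IH] lu; rewrite iterS.
  by rewrite phi_up //=; congr (_, _); lia.
rewrite IH ?(ltnW lu) // /phi edge_next //= lu; congr (_, _) => /=; lia.
Qed.

Lemma phi_iter_last u m : m < nup u ->
  iter (glen u m).+1 phi (u, updart u m) =
  (if m.+1 < nup u then (m.+1, 0) :: u else (0, 0) :: nxt u, q.-1).
Proof.
move=> mu; rewrite iterS -{1}(prednK (glen_gt0 u m)) phi_iter_up //; last first.
  by rewrite prednK ?glen_gt0.
by rewrite /phi edge_next //= prednK ?glen_gt0 // ltnn.
Qed.

Lemma phi_down u m : phi ((m, 0) :: u, q.-1) = (u, unrot (updart u m)).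
Proof. by rewrite /phi edge_down. Qed.

(** The walk goes up, takes [glen u m] edges along the next level, and comes down. It ends at [u] if
    the next upward edge starts there; otherwise one more edge leads from [nxt u] back to [u]. The
    group lengths make the total [p] in both cases. *)
Lemma phi_face u m : valid u -> m < nup u ->
  iter p phi (u, updart u m) = (u, updart u m).
Proof.
move=> vu mu; have := phi_iter_last mu; case: ifP => mu' e.
  have -> : p = (glen u m).+2 by rewrite /glen mu' orbT; lia.
  by rewrite iterS e phi_down; congr (_, _); rewrite /updart; case: nilP.
have [u0|u0] := eqVneq u [::].
  have -> : p = (glen u m).+2 by rewrite /glen u0 /=; lia.
  rewrite iterS e phi_down u0 /=; congr (_, _); rewrite /updart /=.
  by move: mu mu'; rewrite u0 /=; lia.
have -> : p = (glen u m).+3 by rewrite /glen mu' orbF /nilp size_eq0 (negPf u0); lia.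
have nu0 : nxt u != [::] by rewrite -size_eq0 size_nxt size_eq0.
rewrite (iterS (glen u m).+2) (iterS (glen u m).+1) e phi_down /updart /nilp.
rewrite !size_eq0 (negPf u0) (negPf nu0) /=.
rewrite /phi edge_prev //= nxtK //; congr (_, _); lia.
Qed.

(** Every dart lies on the [phi]-orbit of an upward dart, and having period [p] passes along the
    orbit. *)
Lemma phi_iter d : vdart d -> iter p phi d = d.
Proof.
have orb u m n : valid u -> m < nup u ->
    iter p phi (iter n phi (u, updart u m)) = iter n phi (u, updart u m).
  by move=> vu mu; rewrite -iterD addnC iterD phi_face.
have last v : valid v -> v != [::] -> iter p phi ((0, 0) :: v, q.-1) = ((0, 0) :: v, q.-1).
  move=> vv v0; pose u := prv v; have vu : valid u by apply: valid_prv.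
  have mu : (nup u).-1 < nup u by rewrite prednK ?nup_gt0.
  have := phi_iter_last mu; rewrite prednK ?nup_gt0 // ltnn prvK // => e.
  by rewrite -e orb.
case/dartP => [u m vu mu|v vv v0|v vv v0|u m vu mu].
- exact: phi_face.
- have := last v vv v0; have -> : (v, 0) = phi ((0, 0) :: v, q.-1).
    by rewrite phi_down /updart /nilp size_eq0 (negPf v0).
  by move=> e; rewrite -iterSr iterS e.
- case: v vv v0 => // -[m l] u /and3P[vu mu lu] _.
  by rewrite -phi_iter_up // orb.
- case: m mu => [|m] mu; last first.
    have := phi_iter_last (ltnW mu); rewrite mu => <-; by rewrite orb ?(ltnW mu).
  have [u0|u0] := eqVneq u [::]; last exact: last.
  rewrite u0; have mu' : q.-1 < nup [::] by rewrite /=; lia.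
  have := phi_iter_last mu'; rewrite ifF; first by move=> <-; rewrite orb.
  by rewrite /=; lia.
Qed.

(** Every step flips the sign of a flag, and conjugation by [step j] turns the composite into its
    inverse, so flags of one sign suffice. *)
Lemma iter_step_pos i j n : (forall x, x.2 -> vflag x -> iter n (step j \o step i) x = x) ->
  forall x, vflag x -> iter n (step j \o step i) x = x.
Proof.
move=> h x vx; case: (boolP x.2) => xs; first exact: h.
have vy := step_valid j vx.
have ys : (step j x).2 by case: (j).
rewrite -{1}(stepK j vx) iter_step_conj // [in LHS]iter_step_sym ?stepK //.
exact: h.
Qed.

Lemma iter_step_12 x : vflag x -> iter q (step G2 \o step G1) x = x.
Proof.
apply: iter_step_pos => -[[v k] s] /= -> /andP[_ /= kq].
rewrite -[in RHS](iter_rot_q kq); move: (q) => n.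
by elim: n => //= n ->.
Qed.

Lemma iter_step_01 x : vflag x -> iter p (step G1 \o step G0) x = x.
Proof.
apply: iter_step_pos => -[d s] /= -> vd.
rewrite -[in RHS](phi_iter (vd : vdart d)); move: (p) => n.
by elim: n => //= n ->.
Qed.

Lemma step_rel i j x : vflag x ->
  foldl (fun y g => step g y) x (altw i j (2 * triangle_order p q i j)) = x.
Proof.
have r02 y : vflag y -> iter 2 (step G2 \o step G0) y = y.
  by case: y => d s vd; rewrite /step /= !negbK edgeK.
move=> vx; rewrite foldl_altw; case: i; case: j.
- exact: (stepK G0 vx).
- exact: iter_step_01.
- exact: r02.
- exact: (iter_step_sym vx (iter_step_01 vx)).
- exact: (stepK G1 vx).
- exact: iter_step_12.
- exact: (iter_step_sym vx (r02 _ vx)).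
- exact: (iter_step_sym vx (iter_step_12 vx)).
- exact: (stepK G2 vx).
Qed.
End LayeredMap.

(** * Walks on flags, and the belts of the faces of the layered map *)

Section LayeredMapTheory.
Local Open Scope nat_scope.
Variables (p q : nat).
Hypotheses (q_gt3 : 3 < q) (p_gt3 : 3 < p).
Implicit Types (u v : vtx) (x y : flag).

Local Notation nup := (nup q).
Local Notation glen := (glen p q).
Local Notation valid := (valid p q).
Local Notation nxt := (nxt p q).
Local Notation prv := (prv p q).
Local Notation edge := (edge p q).
Local Notation vdart := (vdart p q).
Local Notation vflag := (vflag p q).
Local Notation step := (step p q).
Local Notation rot := (rot q).
Local Notation unrot := (unrot q).

(** Words act on flags with the first letter first, whereas [wact] applies the last letter first: a
    step to an adjacent triangle appends a generator on the right. *)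
Definition walk x (w : seq gen) : flag := foldl (fun y g => step g y) x w.

Definition root_flag : flag := ([::], 0, true).

Lemma root_flag_valid : vflag root_flag.
Proof. by rewrite /vflag /vdart /=; lia. Qed.

Lemma walk_valid x w : vflag x -> vflag (walk x w).
Proof. by elim: w x => //= g w IH x vx; apply: IH; apply: step_valid. Qed.

Lemma walk_cat x w w' : walk x (w ++ w') = walk (walk x w) w'.
Proof. exact: foldl_cat. Qed.

Lemma cox_walk w w' x : cox (triangle_order p q) w w' -> vflag x -> walk x w = walk x w'.
Proof.
move=> h; apply: (cox_foldl (P := fun x => vflag x)) h => [g y|i j y].
  exact: step_valid.
exact: step_rel.
Qed.

Let reachable x := exists w, walk root_flag w = x.

Let reach_step g x : reachable x -> reachable (step g x).
Proof. by case=> w <-; exists (rcons w g); rewrite /walk foldl_rcons. Qed.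

Let reach_vertex v k s k' s' : reachable (v, k, s) -> k < q -> k' < q ->
  reachable (v, k', s').
Proof.
move=> r kq k'q.
have {}r : reachable (v, k, true).
  by case: s r => // /(reach_step G2).
have {}r : reachable (v, k', true).
  have -> : k' = iter (q - k + k') rot k.
    by rewrite iter_rot // addnA subnKC ?(ltnW kq) // modnDl modn_small.
  by elim: (q - k + k') => //= n /(reach_step G1) /(reach_step G2).
by case: s' => //; apply: (reach_step G2 r).
Qed.

(** The flags at one vertex are connected by [G1] and [G2]; a vertex is reached from its parent
    through the head of its group and then along the level. *)
Lemma walk_transitive x : vflag x -> exists w, walk root_flag w = x.
Proof.
case: x => -[v k] s; rewrite /vflag /vdart /= => /andP[vv kq].
elim: v vv k s kq => [|[m l] u IH] vv k s kq.
  by apply: (@reach_vertex _ 0 true) => //; [exists [::] | lia].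
case/and3P: (vv) => vu mu lu.
elim: l vv lu k s kq => [|l IHl] vv lu k s kq.
  have r := reach_step G0 (IH vu (updart u m) true (updart_lt q_gt3 mu)).
  by rewrite /step edge_up // in r; apply: reach_vertex r _ _ => //; lia.
have l_lt : l < glen u m by apply: ltnW.
have vl : valid ((m, l) :: u) by apply/and3P.
have r : reachable ((m, l) :: u, (nup ((m, l) :: u)).+1, true).
  by apply: IHl => //; apply: nup_lt.
have := reach_step G0 r; rewrite /step edge_next // => {}r.
by move: r; rewrite /= lu => r; apply: reach_vertex r _ _ => //; lia.
Qed.

Definition on_face (w : seq gen) : bool := all (mem [:: G0; G1]) w.

Lemma on_face_rev w : on_face (rev w) = on_face w.
Proof. exact: all_rev. Qed.

Lemma on_face_cat w w' : on_face (w ++ w') = on_face w && on_face w'.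
Proof. exact: all_cat. Qed.

(* The belt that the face of a flag belongs to: its darts at v between 0 and
   nup v + 1 bound faces beyond the level of v, the others the faces below. *)
Definition belt_index x : nat :=
  let: (v, k, s) := x in
  if nilp v then 1
  else if (if s then k else unrot k) <= nup v then (size v).+1 else size v.

Lemma belt_index_size x : size x.1.1 <= belt_index x <= (size x.1.1).+1.
Proof. by case: x => -[[|a v] k] s //=; case: ifP => _; rewrite !(leqnn, leqnSn). Qed.

Lemma belt_index_phi d : vdart d -> belt_index (phi p q d, true) = belt_index (d, true).
Proof.
case/(dartP q_gt3 p_gt3) => [u m vu mu|v vv v0|v vv v0|u m vu mu].
- rewrite phi_up // /belt_index /updart /nilp /=.
  by case: u vu mu => [|b u] //= _ mu; rewrite ?mu ifF //; lia.
- rewrite /phi edge_prev // /belt_index /= leqnn size_prv /nilp size_prv.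
  by rewrite size_eq0 (negPf v0).
- rewrite /phi edge_next // /belt_index /nilp /= size_nxt size_eq0 (negPf v0) ltnn.
  rewrite ifF //; apply/negbTE; have := @nup_lt q q_gt3 (nxt v).
  by rewrite -size_eq0 size_nxt size_eq0 => /(_ v0); lia.
- rewrite phi_down // /belt_index /updart /nilp /=.
  have -> : (q.-1 <= q - 3) = false by lia.
  by case: u vu mu => [|b u] // _ mu; rewrite /= (ltnW mu).
Qed.

Lemma belt_index_step g x : vflag x -> g != G2 -> belt_index (step g x) = belt_index x.
Proof.
have pos d : vdart d -> belt_index (step G0 (d, true)) = belt_index (d, true).
  by move=> vd; rewrite -belt_index_phi // /phi /step [(_, _).1]/=; case: (edge d).
case: x => d s vx; have vd : vdart d := vx; case: g => // _ {vx}.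
  case: s; first exact: pos.
  have ve := edge_valid q_gt3 p_gt3 vd.
  rewrite -[RHS]/(belt_index (d, ~~ true)) -{2}(edgeK q_gt3 p_gt3 vd).
  by rewrite -[RHS]/(belt_index (step G0 (edge d, true))) pos.
case: d vd => v k /andP[_ /= kq]; case: s; last by [].
by rewrite /= rotK.
Qed.

Lemma belt_index_face x w : vflag x -> on_face w -> belt_index (walk x w) = belt_index x.
Proof.
elim: w x => //= g w IH x vx /andP[gf wf].
by rewrite IH ?belt_index_step //; [case: g gf|apply: step_valid].
Qed.

Let face_pos x : vflag x -> exists w k, [/\ on_face w, walk x w = (x.1.1, k, true)
  & k < q].
Proof.
case: x => -[v k] s vx; case/andP: (vx) => /= _ kq; case: s vx => vx.
  by exists [::], k.
by exists [:: G1], (unrot k); split => //; apply: unrot_lt.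
Qed.

(** The walk stays on the face below the level: it runs back along the group to its type A vertex
    and then down to the parent. *)
Let face_next v : valid v -> v != [::] ->
  exists2 w, on_face w & (size (walk (v, (nup v).+1, true) w).1.1).+1 = size v.
Proof.
case: v => // -[m l] u /and3P[vu mu]; elim: l => [|l IH] lu _.
  exists [:: G1; G0] => //; rewrite /walk /= /rot.
  have -> : (q - 3).+2 < q by lia.
  have -> : (q - 3).+2 = q.-1 by lia.
  by rewrite -/(edge ((m, 0) :: u, q.-1)) edge_down.
have [//|//|w wf e] := IH _ _; first exact: ltnW.
exists (G1 :: G0 :: w) => //; rewrite -[RHS]/(size ((m, l) :: u)) -e /walk /= /rot.
by have -> : (q - 2).+2 < q = false by lia.
Qed.

(** With [face_high] this shows that a face touches exactly two consecutive levels, the higher one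
    being its belt index. *)
Lemma face_low x : vflag x ->
  exists2 w, on_face w & (size (walk x w).1.1).+1 = belt_index x.
Proof.
move=> vx; have [w [k [wf e kq]]] := face_pos vx.
rewrite -(belt_index_face vx wf) e; have vv : valid x.1.1 by case/andP: vx.
move: (x.1.1) vv e => v vv e.
suff [w' wf' e'] : exists2 w', on_face w' &
    (size (walk (v, k, true) w').1.1).+1 = belt_index (v, k, true).
  by exists (w ++ w'); rewrite ?on_face_cat ?wf // walk_cat e.
have vd : vdart (v, k) by rewrite /vdart /= vv.
case: (dartP q_gt3 p_gt3 vd) => {vd e}.
- move=> u m vu mu; exists [::] => //=; rewrite /updart.
  by case: nilP => [->|] //=; rewrite mu.
- by move=> {vv} u vu u0; exists [::] => //=; rewrite /nilp size_eq0 (negPf u0).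
- move=> {vv} u vu u0; have [w' wf' e'] := face_next vu u0.
  by exists w' => //; rewrite e' /= /nilp size_eq0 (negPf u0) ltnn.
- move=> u m vu mu; exists [:: G0] => //.
  rewrite /walk /= -/(edge ((m, 0) :: u, q.-1)) edge_down //=.
  by rewrite ifF //; lia.
Qed.

Lemma face_high x : vflag x ->
  exists2 w, on_face w & size (walk x w).1.1 = belt_index x.
Proof.
move=> vx; have [w [k [wf e kq]]] := face_pos vx.
rewrite -(belt_index_face vx wf) e; have vv : valid x.1.1 by case/andP: vx.
move: (x.1.1) vv e => v vv e.
suff [w' wf' e'] : exists2 w', on_face w' &
    size (walk (v, k, true) w').1.1 = belt_index (v, k, true).
  by exists (w ++ w'); rewrite ?on_face_cat ?wf // walk_cat e.
have vd : vdart (v, k) by rewrite /vdart /= vv.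
case: (dartP q_gt3 p_gt3 vd) => {vd e}.
- move=> u m vu mu; exists [:: G0] => //.
  rewrite /walk /= -/(edge (u, updart u m)) edge_up //= /updart.
  by case: nilP => [->|] //=; rewrite mu.
- move=> {vv} u vu u0; exists [:: G1; G0] => //=.
  rewrite /rot; have -> : 1 < q by lia.
  have -> : 1 = updart u 0 by rewrite /updart /nilp size_eq0 (negPf u0).
  by rewrite -/(edge (u, updart u 0)) edge_up ?nup_gt0 //= /nilp size_eq0 (negPf u0).
- move=> {vv} u vu u0; exists [::] => //=.
  by rewrite /nilp size_eq0 (negPf u0) ltnn.
- move=> u m vu mu; exists [::] => //=.
  by rewrite ifF //; lia.
Qed.

Lemma vertex_outer v : valid v -> exists2 x, vflag x & x.1.1 = v /\ belt_index x = (size v).+1.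
Proof.
move=> vv; exists (v, 0, true); first by rewrite /vflag /vdart /= vv; lia.
by split => //; case: (v).
Qed.

Lemma vertex_inner v : valid v -> v != [::] ->
  exists2 x, vflag x & x.1.1 = v /\ belt_index x = size v.
Proof.
move=> vv v0; exists (v, q.-1, true); first by rewrite /vflag /vdart /= vv; lia.
split => //=; rewrite /nilp size_eq0 (negPf v0) ifF //.
by have := nup_lt q_gt3 v0; lia.
Qed.

Lemma edge_child d : vdart d -> size (edge d).1 = (size d.1).+1 ->
  exists2 m, m < nup d.1 & (edge d).1 = (m, 0) :: d.1.
Proof.
case/(dartP q_gt3 p_gt3) => [u m vu mu|u vu u0|u vu u0|u m vu mu].
- by rewrite edge_up // => _; exists m.
- by rewrite edge_prev //= size_prv; lia.
- by rewrite edge_next //= size_nxt; lia.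
- by rewrite edge_down //=; lia.
Qed.
End LayeredMapTheory.

(** * The developing map *)

Section Developing.
Local Open Scope nat_scope.
Variables (p q : nat).
Hypotheses (q_gt3 : 3 < q) (p_gt3 : 3 < p).
Variables (T : Type) (S : gen -> T -> T) (base : T -> T).
Hypotheses (SK : forall g, involutive (S g)).
Hypotheses (S02 : forall y, S G0 (S G2 y) = S G2 (S G0 y)).
Hypotheses (S01 : forall y, iter p (S G0 \o S G1) y = y).
Hypotheses (S12 : forall y, iter q (S G1 \o S G2) y = y).
Implicit Types (u v : vtx) (x : flag) (y z : T).

Local Notation nup := (nup q).
Local Notation glen := (glen p q).
Local Notation valid := (valid p q).
Local Notation nxt := (nxt p q).
Local Notation prv := (prv p q).
Local Notation edge := (edge p q).
Local Notation vdart := (vdart p q).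
Local Notation vflag := (vflag p q).
Local Notation step := (step p q).
Local Notation rot := (rot q).
Local Notation unrot := (unrot q).

(** [rho], [flip] and [face] are the rotations about the vertex, the edge midpoint and the cell
    centre. *)
Let rho y := S G1 (S G2 y).
Let flip y := S G0 (S G2 y).
Let face y := S G0 (S G1 y).

Let rho_q y : iter q rho y = y. Proof. exact: S12. Qed.
Let face_p y : iter p face y = y. Proof. exact: S01. Qed.

Let rho_pred y : iter q.-1 rho y = S G2 (S G1 y).
Proof.
rewrite -[in LHS](SK G1 y) -{1}(SK G2 (S G1 y)) -/(rho _) -iterSr.
by rewrite prednK ?rho_q //; lia.
Qed.

Let flipK y : flip (flip y) = y.
Proof. by rewrite /flip -S02 !SK. Qed.

Let flip_rho_pred y : flip (iter q.-1 rho y) = face y.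
Proof. by rewrite rho_pred /flip SK. Qed.

(* S composed along a path of the layered map from the root to the dart 0 of a
   vertex: the path climbs to the parent of v's group, up to the first vertex of
   the group, then along the level. *)
Fixpoint dev_vertex v y : T :=
  match v with
  | [::] => base y
  | (m, l) :: u => dev_vertex u (iter (updart u m) rho (flip (rho
      (if l is l'.+1 then
         iter (q - 2) rho (flip (iter l' (fun z => iter q.-1 rho (flip z)) y))
       else y))))
  end.

Definition dev x y : T :=
  dev_vertex x.1.1 (iter x.1.2 rho (if x.2 then y else S G2 y)).

Let dev_group u m l y :
  dev_vertex ((m, l.+1) :: u) y =
  dev_vertex ((m, l) :: u) (iter (nup ((m, l) :: u)).+1 rho (flip y)).
Proof.
case: l => [|l]; first by have -> : (nup ((m, 0) :: u)).+1 = q - 2 by rewrite /=; lia.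
have -> : (nup ((m, l.+1) :: u)).+1 = q.-1 by rewrite /=; lia.
by cbn [dev_vertex]; rewrite iterSr.
Qed.

(** All vertices of a group lie on one face, so the way from the parent along the group amounts to
    [l.+1] turns about the centre of that face. *)
Let dev_group_face u m l y :
  dev_vertex ((m, l) :: u) (iter (nup ((m, l) :: u)).+1 rho y) =
  dev_vertex u (iter (updart u m) rho (iter l.+1 face y)).
Proof.
elim: l y => [|l IH] y.
  have -> : (nup ((m, 0) :: u)).+1 = q - 2 by rewrite /=; lia.
  have e : q.-1 = (q - 2).+1 by lia.
  by rewrite /= -iterS -e flip_rho_pred.
rewrite dev_group IH [(nup ((m, l.+1) :: u)).+1]/=.
have -> : (q - 2).+1 = q.-1 by lia.
by rewrite flip_rho_pred -iterSr.
Qed.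

(** [face] has order dividing [p]: the two turns missing to close the face, three in [face_p3], are
    expressed through edges and vertices. *)
Let face_p2 y : iter (p - 2) face (flip y) = rho (flip (rho y)).
Proof.
have e z : iter (p - 2) face (face (face z)) = z.
  by rewrite -!iterSr; have -> : (p - 2).+2 = p by lia.
rewrite -[RHS]e /face /rho /flip !SK; congr (iter _ _ _).
by rewrite -S02 !SK.
Qed.

Let face_p3 y : iter (p - 3) face (flip y) = rho (flip (rho (flip (rho y)))).
Proof.
have e z : iter (p - 3) face (face (face (face z))) = z.
  by rewrite -!iterSr; have -> : (p - 3).+3 = p by lia.
rewrite -[RHS]e /face /rho /flip !SK; congr (iter _ _ _).
by rewrite -S02 !SK -S02 !SK.
Qed.

(** Inside a group this is the definition. At its end the face under the level edge closes up,
    either at the same parent or, by induction, through the edge from [u] to [nxt u]; at the root a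
    full turn of [rho] closes level 1. *)
Let dev_next v y : valid v -> v != [::] ->
  dev_vertex (nxt v) y = dev_vertex v (iter (nup v).+1 rho (flip y)).
Proof.
elim: v y => // -[m l] u IH y /and3P[vu mu lu] _.
rewrite [nxt _]/=; case: ifP => h; first exact: dev_group.
have lE : l.+1 = glen u m by lia.
rewrite dev_group_face lE; case: ifP => h'.
  rewrite /glen h' orbT face_p2 /= /updart.
  by case: nilP => _; rewrite -?iterSr // iterS -iterSr.
have [u0|u0] := eqVneq u [::].
  rewrite u0 /glen /= face_p2 /updart /=.
  have -> : m = q.-1 by move: mu h'; rewrite u0 /=; lia.
  by rewrite -iterSr prednK ?rho_q //; lia.
have un0 : nilp u = false by rewrite /nilp size_eq0 (negPf u0).
rewrite /glen h' un0 face_p3 /= {1}/updart /nilp size_nxt -/(nilp u) un0 /= IH //.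
rewrite /updart un0; congr (dev_vertex _ _).
have -> : m.+1 = nup u by lia.
by rewrite -iterSr.
Qed.

Let dev_up u m y : dev_vertex ((m, 0) :: u) (iter q.-1 rho y) =
  dev_vertex u (iter (updart u m) rho (flip y)).
Proof.
rewrite /=; congr (dev_vertex _ (iter _ _ (flip _))).
by rewrite -iterS prednK ?rho_q //; lia.
Qed.

Let dev_edge d y : vdart d ->
  dev_vertex (edge d).1 (iter (edge d).2 rho y) = dev_vertex d.1 (iter d.2 rho (flip y)).
Proof.
case/(dartP q_gt3 p_gt3) => [u m vu mu|u vu u0|u vu u0|u m vu mu].
- by rewrite edge_up // dev_up.
- have pu0 : prv u != [::] by rewrite -size_eq0 size_prv size_eq0.
  rewrite edge_prev //= -[in RHS](prvK q_gt3 p_gt3 vu) dev_next ?flipK //.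
  exact: valid_prv.
- by rewrite edge_next // dev_next.
- rewrite edge_down // -[RHS]/(dev_vertex ((m, 0) :: u) (iter q.-1 rho (flip y))).
  by rewrite dev_up flipK.
Qed.

(** Adjacent flags differ by a generator applied first, as adjacent triangles do: [G0] crosses an
    edge, [G1] turns about the vertex, and [G2] only changes the side of the dart. *)
Lemma dev_step g x y : vflag x -> dev (step g x) y = dev x (S g y).
Proof.
case: x => d s vd; have {}vd : vdart d := vd; case: g.
- by rewrite /dev /step; case: s => /=; rewrite dev_edge // /flip ?SK // S02.
- case: d vd => v k /andP[_ /= kq]; case: s; rewrite /dev /=.
    congr dev_vertex; rewrite /rot; case: ltnP => kq' /=.
      by rewrite -iterS iterSr /rho SK.
    have {kq'} kE : q = k.+1 by lia.
    by rewrite -[LHS]rho_q {1}kE iterSr /rho SK.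
  congr dev_vertex; case: k kq => [|k] kq /=; first by rewrite rho_pred.
  by rewrite -iterS iterSr /rho !SK.
- by rewrite /dev /=; case: s => //=; rewrite SK.
Qed.

Lemma dev_walk w x y : vflag x -> dev (walk p q x w) y = dev x (foldr S y w).
Proof.
elim/last_ind: w y => // w g IH y vx.
rewrite /walk foldl_rcons -/(walk p q x w) dev_step; last exact: walk_valid.
by rewrite IH // foldr_rcons.
Qed.
End Developing.

(** * The triangle of the mosaic in the hyperboloid model *)

Section Lorentz.
Variable R : realType.
Implicit Types (x y z n : 'rV[R]_3).

Definition vec3 (a b c : R) : 'rV[R]_3 := \row_(j < 3) [:: a; b; c]`_j.

Lemma vec3_0 a b c : vec3 a b c 0 0 = a. Proof. by rewrite mxE. Qed.
Lemma vec3_1 a b c : vec3 a b c 0 1 = b. Proof. by rewrite mxE. Qed.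
Lemma vec3_2 a b c : vec3 a b c 0 ord_max = c. Proof. by rewrite mxE. Qed.
Definition vec3E := (vec3_0, vec3_1, vec3_2).

Lemma row3P x y :
  x 0 0 = y 0 0 -> x 0 1 = y 0 1 -> x 0 ord_max = y 0 ord_max -> x = y.
Proof.
move=> h0 h1 h2; apply/rowP => -[[|[|[|//]]] h].
- by have -> : Ordinal h = 0 by apply: val_inj.
- by have -> : Ordinal h = 1 by apply: val_inj.
- by have -> : Ordinal h = ord_max by apply: val_inj.
Qed.

Lemma lor_sym x y : lor x y = lor y x.
Proof. by rewrite /lor; ring. Qed.

Lemma lor_add x y z : lor (x + y) z = lor x z + lor y z.
Proof. by rewrite /lor !mxE; ring. Qed.

Lemma lor_scale a x y : lor (a *: x) y = a * lor x y.
Proof. by rewrite /lor !mxE; ring. Qed.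

Lemma lor_sum (I : finType) (t : I -> R) (P : I -> 'rV[R]_3) z :
  lor (\sum_k t k *: P k) z = \sum_k t k * lor (P k) z.
Proof.
have lor0 : lor 0 z = 0 by rewrite -(scale0r (0 : 'rV[R]_3)) lor_scale mul0r.
rewrite (big_morph (fun x => lor x z) (fun x y => lor_add x y z) lor0).
by apply: eq_bigr => k _; apply: lor_scale.
Qed.

Lemma lor_vec3 a b c a' b' c' :
  lor (vec3 a b c) (vec3 a' b' c') = a * a' + b * b' - c * c'.
Proof. by rewrite /lor !vec3E. Qed.

Lemma line_reflection_scale c n x : c != 0 -> line_reflection (c *: n) x = line_reflection n x.
Proof.
move=> c0; rewrite /line_reflection lor_scale !(lor_sym _ (c *: n)) !lor_scale scalerA.
congr (_ - _ *: _); rewrite (lor_sym n x); have [->|n0] := eqVneq (lor n n) 0.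
  by rewrite !mulr0 invr0 !mulr0 mul0r.
by field; rewrite n0 c0.
Qed.

Lemma cos_ge_far (a x : R) : 0 <= a <= pi -> a <= x <= pi *+ 2 - a -> cos x <= cos a.
Proof.
move=> /andP[a0 ap] /andP[ax xa]; have pi0 := pi_gt0 R.
have mono (s : R) : a <= s -> s <= pi -> cos s <= cos a.
  move=> as_ sp; by rewrite leNgt ltr_cos ?in_itv /= -?leNgt //; apply/andP; split; lra.
have [xp|px] := lerP x pi; first exact: mono.
have -> : cos x = cos (pi *+ 2 - x).
  by rewrite addrC cosD2pi cosN.
by apply: mono; move: xa; rewrite mulr2n; lra.
Qed.
End Lorentz.

(** * The triangle with angles pi/2, pi/p, pi/q and the base polygon *)

Section TriangleGroup.
Variables (R : realType) (p q : nat).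
Hypotheses (q_gt3 : (3 < q)%N) (p_gt3 : (3 < p)%N) (pq : (4 < (p - 2) * (q - 2))%N).

Let a : R := pi / p%:R.
Let b : R := pi / q%:R.
(** [A] and [C] are the hyperbolic cosine and sine of the inradius of the base polygon, [ch] and
    [sh] those of its circumradius. *)
Let A : R := cos b / sin a.
Let C : R := Num.sqrt (A ^+ 2 - 1).
Let ch : R := cosh_circumradius R p q.
Let sh : R := Num.sqrt (ch ^+ 2 - 1).

Let pR : (3 : R) < p%:R. Proof. by rewrite ltr_nat. Qed.
Let qR : (3 : R) < q%:R. Proof. by rewrite ltr_nat. Qed.

(** The condition on [p] and [q] says that 1/p + 1/q < 1/2, with denominators cleared. *)
Let ab_lt : a + b < pi / 2.
Proof.
have h : (2 * (p%:R + q%:R) : R) < p%:R * q%:R.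
  by rewrite -natrD -!natrM ltr_nat; move: pq p_gt3 q_gt3; nia.
have pi0 := pi_gt0 R.
have -> : a + b = pi * ((p%:R + q%:R) / (p%:R * q%:R)).
  by rewrite /a /b; field; apply/andP; split; apply: lt0r_neq0; move: pR qR; lra.
rewrite ltr_pM2l // ltr_pdivrMr ?mulr_gt0; move: pR qR h; lra.
Qed.

Let a_gt0 : 0 < a. Proof. by rewrite divr_gt0 ?pi_gt0 //; move: pR; lra. Qed.
Let b_gt0 : 0 < b. Proof. by rewrite divr_gt0 ?pi_gt0 //; move: qR; lra. Qed.

Let sa_gt0 : 0 < sin a.
Proof. by apply: sin_gt0_pihalf; move: a_gt0 b_gt0 ab_lt; lra. Qed.
Let sb_gt0 : 0 < sin b.
Proof. by apply: sin_gt0_pihalf; move: a_gt0 b_gt0 ab_lt; lra. Qed.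
Let ca_gt0 : 0 < cos a.
Proof. by apply: cos_gt0_pihalf; move: a_gt0 b_gt0 ab_lt; lra. Qed.
Let cb_gt0 : 0 < cos b.
Proof. by apply: cos_gt0_pihalf; move: a_gt0 b_gt0 ab_lt; lra. Qed.

Let A_gt1 : 1 < A.
Proof.
rewrite /A ltr_pdivlMr // mul1r -[sin a]opprK -cosDpihalf.
have -> : - cos (a + pi / 2) = cos (pi / 2 - a).
  by rewrite cosDpihalf opprK cosB cos_pihalf sin_pihalf; ring.
have ab := ab_lt; have a0 := a_gt0; have b0 := b_gt0.
by rewrite ltr_cos ?in_itv /=; [lra|apply/andP; split; lra|apply/andP; split; lra].
Qed.

Let C_sqr : C ^+ 2 = A ^+ 2 - 1.
Proof. by rewrite sqr_sqrtr // subr_ge0 expr2; have := A_gt1; nra. Qed.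

Let C_gt0 : 0 < C.
Proof. by rewrite sqrtr_gt0 subr_gt0 expr2; have := A_gt1; nra. Qed.

(** The hyperbolic sine law in the right triangle. *)
Let shE : sh = C / sin b.
Proof.
have s0 : sin a != 0 by rewrite gt_eqF.
have sb0 : sin b != 0 by rewrite gt_eqF.
have -> : sh = Num.sqrt ((C / sin b) ^+ 2).
  rewrite /sh; congr Num.sqrt.
  rewrite expr_div_n C_sqr /ch /cosh_circumradius -/a -/b.
  rewrite /A !exprMn !exprVn.
  have := cos2Dsin2 a; have := cos2Dsin2 b; move: (cos a) (cos b) => ca cb hb ha.
  have -> : ca ^+ 2 = 1 - sin a ^+ 2 by rewrite -ha; ring.
  have -> : cb ^+ 2 = 1 - sin b ^+ 2 by rewrite -hb; ring.
  by field; rewrite s0 sb0.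
by rewrite sqrtr_sqr ger0_norm // divr_ge0 // ltW.
Qed.

Let sh_gt0 : 0 < sh. Proof. by rewrite shE divr_gt0. Qed.
Let ch_gt0 : 0 < ch.
Proof. by rewrite /ch /cosh_circumradius -/a -/b !mulr_gt0 ?invr_gt0. Qed.

(** This is cos a = tanh(inradius) / tanh(circumradius); it places [vertex0] on the side with normal
    [root G2]. *)
Let chC : A * cos a * sh = C * ch.
Proof.
rewrite shE /ch /cosh_circumradius -/a -/b /A; field.
by rewrite !gt_eqF.
Qed.

Let sh_ch : sh ^+ 2 - ch ^+ 2 = - 1.
Proof.
rewrite /sh sqr_sqrtr; first by ring.
by rewrite ltW // -sqrtr_gt0.
Qed.

(** Unit normals pointing into the triangle with corners the polygon centre, [vertex0], and the
    midpoint of the side in direction [a]. *)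
Definition root (g : gen) : 'rV[R]_3 :=
  match g with
  | G0 => vec3 (sin a) (- cos a) 0
  | G1 => vec3 0 1 0
  | G2 => vec3 (- A * cos a) (- A * sin a) (- C)
  end.

Lemma triangle_order_sym i j : triangle_order p q i j = triangle_order p q j i.
Proof. by case: i; case: j. Qed.

Lemma triangle_order_gt1 i j : i != j -> (1 < triangle_order p q i j)%N.
Proof. by case: i; case: j => //= _; apply: ltnW; apply: ltnW. Qed.

Lemma lor_root i j : lor (root i) (root j) = - cos (pi / (triangle_order p q i j)%:R).
Proof.
have s0 : sin a != 0 by rewrite gt_eqF.
have sc := cos2Dsin2 a.
have AsE : A * sin a = cos b by rewrite /A; field.
case: i; case: j; rewrite lor_vec3 /= ?divr1 ?cospi ?cos_pihalf -/a -/b ?opprK.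
- by rewrite -sc; ring.
- by ring.
- by ring.
- by ring.
- by ring.
- by rewrite -AsE; ring.
- by ring.
- by rewrite -AsE; ring.
- have -> : 1 = A ^+ 2 * (cos a ^+ 2 + sin a ^+ 2) - C ^+ 2 by rewrite C_sqr sc; ring.
  by ring.
Qed.

(** The sum of the centre, [vertex0] and the side midpoint divided by [C]; only its direction
    matters, so it is not normalised. *)
Definition inner_point : 'rV[R]_3 := vec3 (cos a + sh) (sin a) (1 + A / C + ch).

Lemma inner_point_gt0 i : 0 < lor inner_point (root i).
Proof.
have C0 : C != 0 by rewrite gt_eqF.
have sc := cos2Dsin2 a.
case: i; rewrite lor_vec3.
- have -> : (cos a + sh) * sin a + sin a * - cos a - (1 + A / C + ch) * 0 = sh * sin a by ring.
  by rewrite mulr_gt0.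
- by rewrite mulr0 mulr1 add0r mulr0 subr0.
- have -> : (cos a + sh) * (- A * cos a) + sin a * (- A * sin a) - (1 + A / C + ch) * - C
     = - A * (cos a ^+ 2 + sin a ^+ 2) + C * ch - A * cos a * sh + C + A by field.
  by rewrite sc chC; move: C_gt0; lra.
Qed.

Definition vertex0 : 'rV[R]_3 := vec3 sh 0 ch.

Lemma vertex0_G0 : 0 < lor vertex0 (root G0).
Proof. by rewrite lor_vec3 mulr0 mul0r addr0 subr0 mulr_gt0. Qed.
Lemma vertex0_G1 : lor vertex0 (root G1) = 0.
Proof. by rewrite lor_vec3; ring. Qed.
Lemma vertex0_G2 : lor vertex0 (root G2) = 0.
Proof.
rewrite lor_vec3.
have -> : sh * (- A * cos a) + 0 * (- A * sin a) - ch * - C =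
  C * ch - A * cos a * sh by ring.
by rewrite chC subrr.
Qed.

Lemma cosh_circumradius_gt0 : 0 < ch.
Proof. exact: ch_gt0. Qed.

Lemma vertex0_norm : lor vertex0 vertex0 = -1.
Proof. by rewrite lor_vec3 -sh_ch; ring. Qed.

Lemma roots_nondegenerate x : (forall i, lor x (root i) = 0) -> x = 0.
Proof.
move=> h; have := h G1; have := h G0; have := h G2; rewrite /lor !vec3E !mulr0 !mulr1 add0r !subr0.
move=> h2 h0 h1.
have x0 : x 0 0 = 0.
  by apply: (mulIf (x := sin a)); rewrite ?gt_eqF // mul0r -h0 h1 mul0r addr0.
have xm : x 0 ord_max = 0.
  apply: (mulIf (x := C)); rewrite ?gt_eqF // mul0r -h2 h1 x0; ring.
by apply: row3P; rewrite ?mxE.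
Qed.

(** It identifies the arbitrary normal allowed in [mosaic_reflect], moved to the base side, up to a
    factor. *)
Lemma side_normal n : lor n (root G0) = 0 -> lor n vertex0 = 0 ->
  exists c, n = c *: root G2.
Proof.
rewrite /lor !vec3E !mulr0 !subr0 addr0 => h0 hv.
have sc := cos2Dsin2 a.
have s0 : sin a != 0 by rewrite gt_eqF.
have ca0 : cos a != 0 by rewrite gt_eqF.
have A0 : A != 0 by rewrite gt_eqF // (lt_trans ltr01).
have C0 : C != 0 by rewrite gt_eqF.
have ch0 : ch != 0 by rewrite gt_eqF.
have yE : n 0 1 = n 0 0 * sin a / cos a.
  by apply: (mulIf ca0); rewrite divfK //; move: h0; lra.
have zE : n 0 ord_max = n 0 0 * sh / ch.
  by apply: (mulIf ch0); rewrite divfK //; move: hv; lra.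
have shE' : sh = C * ch / (A * cos a).
  by rewrite -chC; field; rewrite A0 ca0.
exists (- n 0 0 / (A * cos a)); apply: row3P; rewrite mxE !vec3E.
- by field; rewrite A0 ca0.
- by rewrite yE; field; rewrite A0 ca0.
- by rewrite zE shE'; field; rewrite A0 ca0 ch0.
Qed.

Definition base_nat (k : nat) : 'rV[R]_3 :=
  vec3 (sh * cos (k%:R * (a *+ 2))) (sh * sin (k%:R * (a *+ 2))) ch.

Lemma base_polygonE (k : 'I_p) : base_polygon R q k = base_nat k.
Proof.
rewrite /base_polygon -/ch -/sh /base_nat /vec3.
have -> : 2 * pi * k%:R / p%:R = k%:R * (a *+ 2) by rewrite /a -mulr_natl; ring.
by [].
Qed.

Lemma base_nat0 : base_nat 0 = vertex0.
Proof. by rewrite /base_nat mul0r cos0 sin0 mulr1 mulr0. Qed.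

Lemma srefl_base_nat k :
  srefl (@lor R) root G0 (srefl (@lor R) root G1 (base_nat k)) = base_nat k.+1.
Proof.
set t := k%:R * (a *+ 2).
have tE : k.+1%:R * (a *+ 2) = t + a *+ 2 by rewrite -natr1 mulrDl mul1r.
have -> : srefl (@lor R) root G1 (base_nat k) = vec3 (sh * cos t) (- (sh * sin t)) ch.
  apply: row3P; rewrite /srefl lor_vec3 !mxE -/t /=; ring.
rewrite /srefl lor_vec3 /base_nat tE (cosD t) (sinD t) cos_mulr2n sin_mulr2n.
have sc := cos2Dsin2 a.
have -> : cos a ^+ 2 *+ 2 - 1 = 1 - sin a ^+ 2 *+ 2 by rewrite -sc !mulr2n; ring.
apply: row3P; rewrite !mxE /= ?mulr2n; [ring| |ring].
apply/eqP; rewrite -subr_eq0; apply/eqP.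
transitivity (sh * sin t * 2 * (cos a ^+ 2 + sin a ^+ 2 - 1)); first by ring.
by rewrite sc subrr mulr0.
Qed.

Lemma base_nat_G2 k : (k < p)%N -> 0 <= lor (base_nat k) (root G2).
Proof.
move=> kp; rewrite lor_vec3.
set t := k%:R * _.
have -> : sh * cos t * (- A * cos a) + sh * sin t * (- A * sin a) - ch * - C =
  A * sh * (cos a - cos (t - a)) + (C * ch - A * cos a * sh) by rewrite cosB; ring.
rewrite -chC subrr addr0; apply: mulr_ge0.
  by rewrite mulr_ge0 ?(ltW sh_gt0) // ltW // (lt_trans ltr01).
rewrite subr_ge0; have a0 := a_gt0; have b0 := b_gt0; have ab := ab_lt.
have p0 : p%:R != 0 :> R by rewrite gt_eqF // (lt_trans _ pR).
have pa : pi = p%:R * a by rewrite /a; field.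
have pi0 := pi_gt0 R.
(* For [k = 0] the angle is [- a], outside the interval of [cos_ge_far]. *)
have [k0|k0] := eqVneq k 0%N.
  by rewrite /t k0 mul0r sub0r cosN.
apply: cos_ge_far; first by apply/andP; split; lra.
have k1 : (1 : R) <= k%:R by rewrite ler1n lt0n.
have kp1 : (k%:R : R) + 1 <= p%:R by rewrite natr1 ler_nat.
rewrite /t -mulr_natr pa -mulr_natr; apply/andP; split; nra.
Qed.
End TriangleGroup.

(** * Cells, belts and levels *)

Section Mosaic.
Variables (R : realType) (p q : nat).
Hypotheses (q_gt3 : (3 < q)%N) (p_gt3 : (3 < p)%N) (pq : (4 < (p - 2) * (q - 2))%N).
Implicit Types (x y z n : 'rV[R]_3) (w d : seq gen).

Local Notation root := (root R p q).
Local Notation S := (srefl (@lor R) root).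
Local Notation act := (wact (@lor R) root).
Local Notation V0 := (vertex0 R p q).
Local Notation base := (base_polygon R q).
Local Notation order := (triangle_order p q).
Local Notation cox := (cox order).
Local Notation chamber := (chamber (@lor R) root).

Let o_diag : forall i, order i i = 1%N. Proof. by case. Qed.
Let o_sym := @triangle_order_sym p q.
Let o_gt1 := triangle_order_gt1 q_gt3 p_gt3.
Let l_root := lor_root R q_gt3 p_gt3 pq.
Let l_sym := @lor_sym R.
Let l_add := @lor_add R.
Let l_scale := @lor_scale R.

Lemma act_cox w w' x : cox w w' -> act w x = act w' x.
Proof. exact: (cox_wact l_sym l_add l_scale o_diag o_sym o_gt1 l_root). Qed.

Let SK i : involutive (S i).
Proof. exact: (sreflK l_sym l_add l_scale o_diag l_root). Qed.

Let lor_act w x y : lor (act w x) (act w y) = lor x y.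
Proof. exact: (B_wact l_sym l_add l_scale o_diag l_root). Qed.

Let act_revK w : cancel (act w) (act (rev w)).
Proof. exact: (wact_revK l_sym l_add l_scale o_diag l_root). Qed.

Let actK w : cancel (act (rev w)) (act w).
Proof. exact: (wactK l_sym l_add l_scale o_diag l_root). Qed.

Let act_cat w w' x : act (w ++ w') x = act w (act w' x).
Proof. exact: wact_cat. Qed.

Let lor_act_adj w x y : lor (act w x) y = lor x (act (rev w) y).
Proof. exact: (B_wact_adj l_sym l_add l_scale o_diag l_root). Qed.

Let act_sum w (I : finType) (t : I -> R) (P : I -> 'rV[R]_3) :
  act w (\sum_k t k *: P k) = \sum_k t k *: act w (P k).
Proof.
have act0 : act w 0 = 0.
  by rewrite -(scale0r (0 : 'rV[R]_3)) (wact_scale _ l_scale) !scale0r.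
rewrite (big_morph (act w) (fun x y => wact_add _ l_add w x y) act0).
by apply: eq_bigr => k _; apply: wact_scale.
Qed.

Lemma act_fundamental w w' x x' : chamber x -> chamber x' -> act w x = act w' x' ->
  x = x' /\ exists2 z, cox w' (w ++ z) & forall i, i \in z -> lor x (root i) = 0.
Proof.
move=> cx cx' e; have e' : act (rev w ++ w') x' = x by rewrite act_cat -e act_revK.
have [|z wz zx] := chamber_fundamental l_sym l_add l_scale o_diag o_sym o_gt1 l_root
  (w := rev w ++ w') cx'.
  by rewrite e'.
have xx' : x = x' by rewrite -e' (act_cox _ wz) (wact_fix (B := @lor R)).
rewrite xx'; split => //; exists z => //.
by move/(cox_catl o_diag): wz; rewrite revK.
Qed.

Lemma line_reflection_root i x : line_reflection (root i) x = S i x.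
Proof. by rewrite /line_reflection l_root o_diag divr1 cospi opprK divr1. Qed.

Lemma line_reflection_act w n x :
  line_reflection (act w n) (act w x) = act w (line_reflection n x).
Proof.
rewrite /line_reflection !lor_act (wact_add _ l_add).
by rewrite -!scaleNr (wact_scale _ l_scale).
Qed.

Definition rotw k : seq gen := altw G0 G1 (2 * k).

Lemma rotwS k : rotw k.+1 = [:: G0, G1 & rotw k].
Proof. by rewrite /rotw mulnS. Qed.

Lemma rotwD k l : rotw (k + l) = rotw k ++ rotw l.
Proof. by rewrite /rotw mulnDr altw_cat oddM. Qed.

Lemma rotw_mod k : cox (rotw k) (rotw (k %% p)).
Proof.
rewrite {1}(divn_eq k p); elim: (k %/ p)%N => [|n IH]; first exact: cox_refl.
rewrite mulSn -addnA rotwD; apply: cox_trans (cox_cat (cox_rel _ G0 G1) IH).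
exact: cox_refl.
Qed.

Lemma act_rotw k : act (rotw k) V0 = base_nat R p q k.
Proof.
elim: k => [|k IH]; first by rewrite base_nat0.
by rewrite rotwS -srefl_base_nat /= IH.
Qed.

Lemma S_fix_V0 i : i != G0 -> S i V0 = V0.
Proof.
by case: i => // _; rewrite /srefl ?vertex0_G1 ?(vertex0_G2 R q_gt3 p_gt3 pq) mulr0 scale0r subr0.
Qed.

Lemma act_rotw_polygon k (kp : (k %% p < p)%N) : act (rotw k) V0 = base (Ordinal kp).
Proof. by rewrite base_polygonE (act_cox _ (rotw_mod k)) act_rotw. Qed.

Lemma base_act (k : 'I_p) : base k = act (rotw k) V0.
Proof. by rewrite act_rotw base_polygonE. Qed.

Lemma base_ordS (k : 'I_p) : base (ordS k) = act (rotw k) (S G0 V0).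
Proof.
have kp : (k.+1 %% p < p)%N by rewrite ltn_pmod // (ltn_trans _ p_gt3).
have -> : ordS k = Ordinal kp by apply: val_inj.
by rewrite -act_rotw_polygon -(addn1 k) rotwD act_cat /= (S_fix_V0 (i := G1)).
Qed.

(** With [k < p] these are normal forms for the dihedral group of the base polygon, which makes the
    later maximum one over a finite set. *)
Definition dihedral_word (k : nat) (b : bool) : seq gen :=
  rotw k ++ (if b then [:: G1] else [::]).

Lemma on_face_rotw k : on_face (rotw k).
Proof. by elim: k => // k IH; rewrite rotwS. Qed.

Lemma rotw_turn k : cox (rotw k ++ [:: G1; G0]) (rotw (k + p.-1)).
Proof.
have e : rotw (k + p.-1) ++ [:: G0; G1] = rotw (k + p).
  by rewrite -[[:: G0; G1]]/(rotw 1) -rotwD -addnA addn1 prednK // (ltn_trans _ p_gt3).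
have : cox (rotw (k + p.-1) ++ [:: G0; G1]) (rotw k).
  rewrite e rotwD -[X in cox _ X]cats0.
  exact: cox_cat (cox_refl _ _) (cox_rel _ G0 G1).
by move/(cox_catr o_diag)/cox_sym.
Qed.

Lemma dihedral_normal d : on_face d ->
  exists k b, (k < p)%N /\ cox d (dihedral_word k b).
Proof.
suff : on_face d -> exists k b, cox d (dihedral_word k b).
  move=> h /h[k [b e]]; exists (k %% p)%N, b; split.
    by rewrite ltn_pmod // (ltn_trans _ p_gt3).
  apply: cox_trans e _; exact: cox_cat (rotw_mod k) (cox_refl _ _).
elim/last_ind: d => [|d i IH]; first by exists 0%N, false; apply: cox_refl.
rewrite -cats1 on_face_cat => /andP[/IH[k [b e]]] iF.
have {}e := cox_cat e (cox_refl _ [:: i]).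
case: i iF e => // _ e; case: b e => e.
- exists (k + p.-1)%N, false; apply: cox_trans e _.
  by rewrite /dihedral_word -catA cats0; apply: rotw_turn.
- exists k.+1, true; apply: cox_trans e _.
  rewrite /dihedral_word cats0 -(addn1 k) rotwD -catA; apply: cox_cat; first exact: cox_refl.
  rewrite -[rotw 1]/([:: G0] ++ [:: G1]) -catA -[X in cox X _]cats0.
  apply: cox_cat; first exact: cox_refl.
  exact: cox_sym (cox_sq o_diag G1).
- exists k, false; apply: cox_trans e _.
  rewrite /dihedral_word -catA cats0 -[X in cox _ X]cats0.
  exact: cox_cat (cox_refl _ _) (cox_sq o_diag G1).
- by exists k, true; rewrite /dihedral_word cats0 in e.
Qed.

Lemma act_dihedral_V0 d : on_face d -> exists2 k : 'I_p, true & act d V0 = base k.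
Proof.
move=> /dihedral_normal[k [b [kp e]]]; exists (Ordinal kp) => //.
rewrite base_act (act_cox _ e) /dihedral_word act_cat.
by case: b {e} => //=; rewrite S_fix_V0.
Qed.

(* Every point of the base polygon is moved by its dihedral group into the
   triangle with angles pi/2, pi/p, pi/q: apply the element of the group that
   makes the product with an inner point of the triangle largest. *)
Lemma dihedral_chamber (y : 'rV[R]_3) (t : 'I_p -> R) : (forall k, 0 <= t k) ->
  y = \sum_k t k *: base k -> exists2 d, on_face d & chamber (act (rev d) y).
Proof.
move=> t0 yE; have p0 : (0 < p)%N by apply: ltn_trans p_gt3.
pose dw (u : 'I_p * bool) := dihedral_word u.1 u.2.
pose f u := lor (act (rev (dw u)) y) (inner_point R p q).
have [u0 _ umax] := @Order.TotalTheory.arg_maxP _ _ _ (Ordinal p0, false) xpredT f isT.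
set d := dw u0; have df : on_face d.
  by rewrite /d /dw /dihedral_word on_face_cat on_face_rotw /=; case: u0.2.
exists d => // i.
have nonneg e : on_face e -> 0 <= lor (act e V0) (root G2).
  case/act_dihedral_V0 => k _ ->; rewrite base_polygonE.
  exact: base_nat_G2.
(* The dihedral group permutes the polygon vertices, and all of them lie on the inner side of the
   line of [G2]. *)
have [->|iN2] := eqVneq i G2.
  rewrite yE act_sum lor_sum sumr_ge0 // => k _; rewrite mulr_ge0 // base_act -act_cat.
  by apply: nonneg; rewrite on_face_cat on_face_rev df on_face_rotw.
set z := act (rev d) y.
have : f u0 >= lor (S i z) (inner_point R p q).
  have dif : on_face (rcons d i).
    by rewrite -cats1 on_face_cat df /=; case: i iN2 {z}.
  have [k [b [kp e]]] := dihedral_normal dif.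
  have := umax (Ordinal kp, b) isT; rewrite /f.
  suff -> : act (rev (dw (Ordinal kp, b))) y = S i z by [].
  rewrite -[S i z]/(act (i :: rev d) y) -rev_rcons.
  by rewrite -{1}(actK (rcons d i) y) (act_cox _ e) act_revK.
(* Reflecting changes the product by -2 times [lor z (root i)] times a positive number, so
   maximality forces [lor z (root i)] to be nonnegative. *)
rewrite /f -/d -/z {1}/srefl l_add -scaleNr l_scale mulNr gerDl oppr_le0.
by rewrite -mulrA pmulr_rge0 // pmulr_lge0 // l_sym inner_point_gt0.
Qed.

Lemma dihedral_side d : on_face d -> exists k : 'I_p,
  (act d V0 = base k /\ act d (S G0 V0) = base (ordS k)) \/
  (act d V0 = base (ordS k) /\ act d (S G0 V0) = base k).
Proof.
case/dihedral_normal=> k [b [kp e]]; rewrite !(act_cox _ e) /dihedral_word.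
case: b {e}; last first.
  by exists (Ordinal kp); left; rewrite cats0 base_ordS base_act.
(* A final [G1] reverses orientation, so the side runs from vertex [k] back to vertex [k - 1] modulo
   [p]. *)
have lp : ((k + p.-1) %% p < p)%N by rewrite ltn_pmod // (ltn_trans _ p_gt3).
exists (Ordinal lp); right; split.
  have -> : ordS (Ordinal lp) = Ordinal kp.
    apply: val_inj => /=; rewrite -addn1 modnDml -addnA addn1 prednK ?(ltn_trans _ p_gt3) //.
    by rewrite modnDr modn_small.
  by rewrite base_act act_cat /= (S_fix_V0 (i := G1)).
rewrite -act_rotw_polygon -(act_cox _ (rotw_turn k)).
by rewrite !act_cat.
Qed.

Lemma polygon_word P : mosaic_polygon q P ->
  exists w, P = (fun k : 'I_p => act w (base k)).
Proof.
elim=> [|{}P k n _ [w PE] n0 hk hk1]; first by exists [::].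
(* [u] carries the base side of [G2] to side [k] of [P], so the reflection in that side is the
   conjugate of [G2] by [u]. *)
pose u := w ++ rotw k; pose n' := act (rev u) n.
have nE : n = act u n' by rewrite actK.
have hv : lor n' V0 = 0.
  by rewrite lor_act_adj revK l_sym /u act_cat -base_act -hk PE.
have h0 : lor n' (root G0) = 0.
  have : lor n' (S G0 V0) = 0.
    by rewrite lor_act_adj revK l_sym /u act_cat -base_ordS -hk1 PE.
  rewrite l_sym /srefl l_add -scaleNr l_scale (l_sym V0 n') hv add0r => /eqP.
  rewrite mulf_eq0 oppr_eq0 mulf_eq0 pnatr_eq0 /= gt_eqF ?vertex0_G0 //=.
  by move/eqP; rewrite l_sym.
have [c n'E] := side_normal q_gt3 p_gt3 pq h0 hv.
have c0 : c != 0.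
  apply: contraTneq n0 => c0.
  by rewrite nE lor_act n'E l_scale c0 mul0r ltxx.
exists (u ++ [:: G2] ++ rev u ++ w); apply/funext => j; rewrite PE nE n'E.
rewrite (wact_scale _ l_scale) line_reflection_scale // -{1}(actK u (act w (base j))).
by rewrite line_reflection_act line_reflection_root !act_cat.
Qed.

(* The labelled polygons of the mosaic need not be closed under relabelling,
   hence the dihedral factor d. *)
Lemma word_polygon w : exists w' d, [/\ cox w (w' ++ d), on_face d &
  mosaic_polygon q (fun k : 'I_p => act w' (base k))].
Proof.
elim/last_ind: w => [|w i [w' [d [e df mp]]]].
  by exists [::], [::]; split => //; [exact: cox_refl|exact: mosaic_base].
have {}e : cox (rcons w i) (w' ++ rcons d i) by rewrite -rcons_cat; apply: cox_rcons.
have [iE|iN2] := eqVneq i G2; last first.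
  exists w', (rcons d i); split => //.
  by rewrite -cats1 on_face_cat df; case: i iN2 {e}.
(* The inserted word is the conjugate of [G2] by [d], the reflection in a side of the base
   polygon. *)
exists (w' ++ rcons d i ++ rev d), d; split => //.
  apply: cox_trans e _; rewrite -catA; apply: cox_cat; first exact: cox_refl.
  rewrite -catA -[X in cox X _]cats0; apply: cox_cat; first exact: cox_refl.
  exact: cox_sym (cox_revl o_diag _).
have v2 : lor V0 (root G2) = 0 by apply: vertex0_G2.
have v02 : lor (S G0 V0) (root G2) = 0.
  by rewrite /srefl l_add -scaleNr l_scale v2 l_root cos_pihalf oppr0 mulr0 addr0.
have [k hk] := dihedral_side df.
pose n := act w' (act d (root G2)).
have nn : 0 < lor n n by rewrite !lor_act l_root o_diag divr1 cospi opprK.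
have hk0 : lor (act w' (base k)) n = 0.
  by rewrite lor_act; case: hk => -[h1 h2]; rewrite -?h1 -?h2 lor_act.
have hk1 : lor (act w' (base (ordS k))) n = 0.
  by rewrite lor_act; case: hk => -[h1 h2]; rewrite -?h1 -?h2 lor_act.
have := mosaic_reflect mp nn hk0 hk1; congr (mosaic_polygon _ _).
apply/funext => j; rewrite line_reflection_act -{1}(actK d (base j)).
by rewrite line_reflection_act line_reflection_root !act_cat iE -cats1 act_cat.
Qed.

Lemma mosaic_vertexP x : mosaic_vertex p q x <-> exists w, x = act w V0.
Proof.
split=> [[P /polygon_word[w ->] [k ->]]|[w ->]].
  by exists (w ++ rotw k); rewrite act_cat -base_act.
have [w' [d [e df mp]]] := word_polygon w.
have [k _ kE] := act_dihedral_V0 df.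
by exists (fun k => act w' (base k)) => //; exists k; rewrite (act_cox _ e) act_cat kE.
Qed.

Lemma mosaic_edgeP x y :
  mosaic_edge p q x y <-> exists w, x = act w V0 /\ y = act w (S G0 V0).
Proof.
split=> [[P /polygon_word[w ->] [k [[-> ->]|[-> ->]]]]|[w [-> ->]]].
- by exists (w ++ rotw k); rewrite !act_cat -base_act -base_ordS.
- exists (w ++ rotw k ++ [:: G0]); rewrite !act_cat /= (SK G0) -base_act -base_ordS.
  by [].
have [w' [d [e df mp]]] := word_polygon w.
have [k kE] := dihedral_side df.
exists (fun k => act w' (base k)) => //; exists k.
by rewrite !(act_cox _ e) !act_cat; case: kE => -[-> ->]; [left|right].
Qed.

(** A vector and its reflection have product at most -1. If the reflection were not on the upper
    sheet, Cauchy-Schwarz for the first two coordinates would contradict this. *)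
Lemma act_sheet w x : hyperbolic_plane x -> hyperbolic_plane (act w x).
Proof.
elim: w => //= i w IH /IH; move: (act w x) => {IH}x [xx x2].
have nn : lor (S i x) (S i x) = -1 by rewrite -xx -[S i _]/(act [:: i] x) lor_act.
split => //; have : lor x (S i x) <= -1.
  rewrite l_sym /srefl l_add -scaleNr l_scale xx (l_sym (root i)).
  by rewrite gerDl; nra.
move: nn xx; move: (S i x) => y; rewrite ltNge /lor.
move: x2; move: (x 0 0) (x 0 1) (x 0 ord_max) (y 0 0) (y 0 1) (y 0 ord_max).
move=> x0 x1 x2 y0 y1 y2 x2_gt0 yy xx xy; apply/negP => y2_le0.
have cs : (x0 * y0 + x1 * y1) ^+ 2 <= (x0 ^+ 2 + x1 ^+ 2) * (y0 ^+ 2 + y1 ^+ 2).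
  rewrite -subr_ge0.
  have -> : (x0 ^+ 2 + x1 ^+ 2) * (y0 ^+ 2 + y1 ^+ 2) - (x0 * y0 + x1 * y1) ^+ 2
    = (x0 * y1 - x1 * y0) ^+ 2 by ring.
  exact: sqr_ge0.
have le0 : x0 * y0 + x1 * y1 <= x2 * y2 by lra.
have x2y2 : x2 * y2 <= 0 by rewrite pmulr_rle0.
have : (x2 * y2) ^+ 2 <= (x0 * y0 + x1 * y1) ^+ 2 by rewrite !expr2; nra.
have -> : (x2 * y2) ^+ 2 = (x2 * x2) * (y2 * y2) by ring.
have -> : x2 * x2 = 1 + (x0 ^+ 2 + x1 ^+ 2) by rewrite !expr2; lra.
have -> : y2 * y2 = 1 + (y0 ^+ 2 + y1 ^+ 2) by rewrite !expr2; lra.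
have := sqr_ge0 x0; have := sqr_ge0 x1; have := sqr_ge0 y0; have := sqr_ge0 y1.
move=> ????; nra.
Qed.

(** * The tiling seen from the vertex [act w0 V0] *)

Section RootedAt.
Variable w0 : seq gen.
Implicit Types (u v : vtx) (f : flag).

Local Notation valid := (valid p q).
Local Notation vflag := (vflag p q).
Local Notation walk := (walk p q).
Local Notation step := (step p q).
Local Notation edge := (edge p q).
Local Notation belt_index := (belt_index q).

Let iter_alt i j k x : act (altw i j (2 * k)) x = iter k (S i \o S j) x.
Proof. by elim: k => // k IH; rewrite mulnS /= -IH. Qed.

Let S02 x : S G0 (S G2 x) = S G2 (S G0 x).
Proof.
have := wact_rel l_sym l_add l_scale o_diag o_sym o_gt1 l_root G0 G2 x.
by move/(congr1 (S G2 \o S G0)); rewrite /= !SK => ->.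
Qed.
Let S01 x : iter p (S G0 \o S G1) x = x.
Proof.
rewrite -iter_alt.
exact: (wact_rel l_sym l_add l_scale o_diag o_sym o_gt1 l_root G0 G1 x).
Qed.
Let S12 x : iter q (S G1 \o S G2) x = x.
Proof.
rewrite -iter_alt.
exact: (wact_rel l_sym l_add l_scale o_diag o_sym o_gt1 l_root G1 G2 x).
Qed.

Let devf := dev q S (act w0).

(* The flag of the layered map that corresponds to the triangle [act w] of the
   tiling, when the root flag corresponds to [act w0]. *)
Definition flag_of w : flag := walk root_flag (rev w0 ++ w).

Lemma flag_of_valid w : vflag (flag_of w).
Proof. exact: (walk_valid q_gt3 p_gt3 _ (root_flag_valid q_gt3 p_gt3)). Qed.

Lemma flag_of_cat w w' : flag_of (w ++ w') = walk (flag_of w) w'.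
Proof. by rewrite /flag_of catA walk_cat. Qed.

Lemma flag_of_cox w w' : cox w w' -> flag_of w = flag_of w'.
Proof.
move=> e; apply: (cox_walk q_gt3 p_gt3); last exact: root_flag_valid.
exact: cox_cat (cox_refl _ _) e.
Qed.

Let dev_flag w x : devf (flag_of w) x = act w x.
Proof.
rewrite /devf /flag_of (dev_walk q_gt3 p_gt3 _ SK S02 S01 S12) ?root_flag_valid //.
by rewrite -[LHS]/(act w0 (act (rev w0 ++ w) x)) act_cat actK.
Qed.

Lemma flag_of_surj f : vflag f -> exists w, flag_of w = f.
Proof.
case/(walk_transitive q_gt3 p_gt3) => w <-; exists (w0 ++ w).
rewrite /flag_of catA -[in RHS](cat0s w) !(walk_cat _ _ _ _ w); congr (walk _ w).
exact: (cox_walk q_gt3 p_gt3 (cox_revl o_diag w0) (root_flag_valid q_gt3 p_gt3)).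
Qed.

Lemma flag_of_root : flag_of w0 = root_flag.
Proof. exact: (cox_walk q_gt3 p_gt3 (cox_revl o_diag w0) (root_flag_valid q_gt3 p_gt3)). Qed.

(** Any flag at [v] would give the same point, since [G1] and [G2] fix [V0]. *)
Definition point v : 'rV[R]_3 := devf (v, 0%N, true) V0.

Lemma act_point w : act w V0 = point (flag_of w).1.1.
Proof.
rewrite -dev_flag; case: (flag_of w) => -[v k] s; rewrite /point /devf /dev /=.
congr (dev_vertex _ _ _ _).
have -> : (if s then V0 else S G2 V0) = V0 by case: s; rewrite ?S_fix_V0.
by elim: k => //= k ->; rewrite !S_fix_V0.
Qed.

Lemma V0_chamber : chamber V0.
Proof. by case; rewrite ?vertex0_G1 ?(vertex0_G2 R q_gt3 p_gt3 pq) // ltW // vertex0_G0. Qed.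

Lemma walk_vertex f (z : seq gen) : G0 \notin z -> (walk f z).1.1 = f.1.1.
Proof.
elim: z f => //= i z IH f; rewrite inE negb_or => /andP[i0 /IH ->].
by case: i i0.
Qed.

Lemma fix_V0_letters (z : seq gen) : (forall i, i \in z -> lor V0 (root i) = 0) -> G0 \notin z.
Proof.
by move=> h; apply/negP => /h /eqP; rewrite gt_eqF ?vertex0_G0.
Qed.

Let vertex_flag v : valid v -> exists2 w, flag_of w = (v, 0%N, true) & act w V0 = point v.
Proof.
move=> vv; have [|w e] := @flag_of_surj (v, 0%N, true).
  by rewrite /vflag /vdart /= vv; apply: leq_trans q_gt3.
by exists w; rewrite // act_point e.
Qed.

(** Words with the same image of [V0] differ by letters fixing [V0], hence without [G0], and such
    letters keep the vertex of a flag. *)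
Lemma point_inj u v : valid u -> valid v -> point u = point v -> u = v.
Proof.
move=> /vertex_flag[w fw <-] /vertex_flag[w' fw' <-] e.
have [_ [z wz /fix_V0_letters zN]] := act_fundamental V0_chamber V0_chamber e.
have := flag_of_cox wz; rewrite flag_of_cat fw fw' => /(congr1 (fun f => f.1.1)).
by rewrite walk_vertex.
Qed.

(* v is a vertex of the face of f, that face being the orbit of f under G0 and G1. *)
Definition on_flag_face f v : Prop := exists2 d, on_face d & (walk f d).1.1 = v.

Definition polygon_hull w : set 'rV[R]_3 := hyp_hull (fun k : 'I_p => act w (base k)).

Lemma hull_chamber w y : polygon_hull w y ->
  exists d x, [/\ on_face d, chamber x, lor x x = -1 & y = act (w ++ d) x].
Proof.
case=> -[yy _] [t t0 yE]; rewrite -act_sum in yE.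
have [d df cd] := dihedral_chamber t0 (erefl (\sum_k t k *: base k)).
exists d, (act (rev d) (\sum_k t k *: base k)); split => //.
  by rewrite lor_act -yy yE lor_act.
by rewrite act_cat actK.
Qed.

Lemma base_sheet (k : 'I_p) : hyperbolic_plane (base k).
Proof.
rewrite base_act; apply: act_sheet; split; first exact: vertex0_norm.
by rewrite vec3_2; apply: cosh_circumradius_gt0.
Qed.

Lemma polygon_hull_vertex w (k : 'I_p) : polygon_hull w (act w (base k)).
Proof.
split; first by apply: act_sheet; apply: base_sheet.
exists (fun j => (j == k)%:R); first by move=> j; apply: ler0n.
rewrite (bigD1 k) //= eqxx scale1r big1 ?addr0 // => j /negPf ->.
by rewrite scale0r.
Qed.

Lemma hull_point w v : valid v -> polygon_hull w (point v) <-> on_flag_face (flag_of w) v.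
Proof.
move=> vv; split.
  have [w1 fw1 <-] := vertex_flag vv.
  case/hull_chamber=> d [x [df cx _ e]].
  have [xE [z wz zfix]] := act_fundamental V0_chamber cx e.
  exists d => //; rewrite -flag_of_cat (flag_of_cox wz) flag_of_cat walk_vertex ?fw1 //.
  exact: fix_V0_letters.
case=> d df <-; rewrite -flag_of_cat -act_point act_cat.
have [k _ ->] := act_dihedral_V0 df.
exact: polygon_hull_vertex.
Qed.

(* If G1 does not occur in z, then z moves f within the flags of one edge. *)
Let walk_edge f (z : seq gen) : vflag f -> G1 \notin z ->
  (walk f z).1.1 = f.1.1 \/ (step G0 (walk f z)).1.1 = f.1.1.
Proof.
move=> vf; elim/last_ind: z => [|z i IH]; first by left.
rewrite mem_rcons inE negb_or eq_sym => /andP[i1 /IH{IH}].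
rewrite /walk foldl_rcons -/(walk f z).
have vz : vflag (walk f z) by apply: walk_valid.
case: i i1 => // _ [e|e].
  by right; rewrite stepK.
by left.
Qed.

Lemma hulls_meet w w' y : polygon_hull w y -> polygon_hull w' y ->
  exists v, [/\ valid v, on_flag_face (flag_of w) v & on_flag_face (flag_of w') v].
Proof.
move=> /hull_chamber[d [x [df cx xx yE]]] /hull_chamber[d' [x' [df' cx' _]]].
rewrite yE => /(act_fundamental cx cx')[_ [z wz zfix]].
have valid_vert f : vflag f -> valid f.1.1 by case/andP.
have fd' : walk (flag_of w') d' = walk (walk (flag_of w) d) z.
  by rewrite -!flag_of_cat (flag_of_cox wz).
(* A nonzero [x] is not orthogonal to all roots. Without [G0] the word [z] keeps the vertex, without
   [G1] the edge, without [G2] the face; each case yields a common vertex. *)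
have [i iz] : exists i, i \notin z.
  apply: contrapT => /forallNP allz.
  have x0 : x = 0.
    apply: (roots_nondegenerate q_gt3 p_gt3 pq) => i; apply: zfix.
    by apply: contrapT => /negP /allz.
  by move/eqP: xx; rewrite x0 /lor !mxE !mulr0 addr0 subr0 eq_sym oppr_eq0 oner_eq0.
case: i iz => iz.
- exists (walk (flag_of w) d).1.1; split; first by apply/valid_vert/walk_valid/flag_of_valid.
    by exists d.
  by exists d' => //; rewrite fd' walk_vertex.
- exists (walk (flag_of w) d).1.1; split; first by apply/valid_vert/walk_valid/flag_of_valid.
    by exists d.
  have := @walk_edge (walk (flag_of w) d) z; rewrite -fd' => -[]//.
  + by apply: walk_valid => //; apply: flag_of_valid.
  + by exists d'.
  + move=> e; exists (rcons d' G0); first by rewrite -cats1 on_face_cat df'.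
    by rewrite /walk foldl_rcons.
- exists (walk (flag_of w') d').1.1; split; first by apply/valid_vert/walk_valid/flag_of_valid.
    exists (d ++ z); last by rewrite fd' walk_cat.
    rewrite on_face_cat df; apply/allP => i; case: i => // h; by rewrite h in iz.
  by exists d'.
Qed.

Local Notation B0 := (act w0 V0).

Lemma point_root : B0 = point [::].
Proof. by rewrite act_point flag_of_root. Qed.

Lemma flag_face_bel f v : vflag f -> on_flag_face f v ->
  belt_index f = size v \/ belt_index f = (size v).+1.
Proof.
move=> vf [d df <-]; rewrite -(belt_index_face q_gt3 p_gt3 vf df).
by have := belt_index_size q (walk f d); lia.
Qed.

Lemma flag_face_root f : vflag f -> on_flag_face f [::] <-> belt_index f = 1%N.
Proof.
move=> vf; split=> [[d df e]|b1].
  by rewrite -(belt_index_face q_gt3 p_gt3 vf df); case: (walk f d) e => -[[|//] k] s.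
have [d df e] := face_low q_gt3 p_gt3 vf.
by exists d => //; apply: size0nil; lia.
Qed.

Lemma hull_bel w v : valid v -> polygon_hull w (point v) ->
  belt_index (flag_of w) = size v \/ belt_index (flag_of w) = (size v).+1.
Proof. by move=> vv /(hull_point _ vv); apply: flag_face_bel; apply: flag_of_valid. Qed.

(** The word found for a flag is corrected by the dihedral factor of [word_polygon], which stays on
    the face. *)
Lemma exists_polygon f : vflag f -> exists w, [/\ mosaic_cell p q (polygon_hull w),
  belt_index (flag_of w) = belt_index f & forall v, on_flag_face f v -> on_flag_face (flag_of w) v].
Proof.
move=> vf; have [w fw] := flag_of_surj vf; have [w' [d [e df mp]]] := word_polygon w.
have fE : f = walk (flag_of w') d by rewrite -flag_of_cat -(flag_of_cox e).
exists w'; split.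
- by exists (fun k => act w' (base k)).
- by rewrite fE (belt_index_face q_gt3 p_gt3) // flag_of_valid.
- move=> v [d' df' <-]; exists (d ++ d'); first by rewrite on_face_cat df.
  by rewrite walk_cat -fE.
Qed.

Definition belt_words (i : nat) (C : set 'rV[R]_3) : Prop :=
  exists w, [/\ mosaic_cell p q (polygon_hull w), C = polygon_hull w & belt_index (flag_of w) = i].

Lemma cell_words C : mosaic_cell p q C -> exists i, belt_words i C.
Proof.
move=> [P mP CE]; have [w PE] := polygon_word mP.
by exists (belt_index (flag_of w)), w; rewrite /polygon_hull -PE -CE; split => //; exists P.
Qed.

Lemma belt1 C : belt p q B0 1 C <-> belt_words 1 C.
Proof.
rewrite /= point_root; split=> [[mC C0]|[w [mC -> w1]]].
  have [i [w [mw CE wi]]] := cell_words mC; exists w; split => //.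
  by apply/flag_face_root; [exact: flag_of_valid|apply/hull_point => //; rewrite -CE].
split => //; apply/hull_point => //.
by apply/flag_face_root => //; apply: flag_of_valid.
Qed.

(** Meeting cells share a vertex, and the index of each is the level of that vertex or one more.
    Belt 0 is a point and not a family of cells, hence the guard. *)
Lemma meets_belt_words i w : (i != 0%N -> belt p q B0 i = belt_words i) ->
  meets_belt (belt p q B0 i) (polygon_hull w) ->
  (belt_index (flag_of w) <= i.+1)%N /\ (i <= (belt_index (flag_of w)).+1)%N.
Proof.
have vw := flag_of_valid w; case: i => [_|i /(_ isT) ->].
  case=> D -> [y [hy y0]]; move: hy; rewrite y0 point_root => /(hull_point w (isT : valid [::])).
  by move/(flag_face_root vw) => ->.
case=> D [w' [_ -> w'i]] [y [hy hy']].
have [v [vv /(flag_face_bel vw) h1 /(flag_face_bel (flag_of_valid w')) h2]] := hulls_meet hy hy'.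
by move: h1 h2; rewrite w'i; lia.
Qed.

Lemma belt_words_meets i w : (i != 0%N -> belt p q B0 i = belt_words i) ->
  mosaic_cell p q (polygon_hull w) ->
  belt_index (flag_of w) = i.+1 \/ (i != 0%N /\ belt_index (flag_of w) = i) ->
  meets_belt (belt p q B0 i) (polygon_hull w).
Proof.
have vw := flag_of_valid w; move=> iE mw h.
case: i iE h => [_|i /(_ isT) iE] h.
  have {}h : belt_index (flag_of w) = 1%N by case: h => // -[].
  exists [set B0] => //; exists B0; split => //; rewrite point_root.
  by apply/hull_point => //; apply/flag_face_root.
rewrite iE; case: h => [h|[_ h]]; last first.
  exists (polygon_hull w); first by exists w.
  have p0 : (0 < p)%N by apply: ltn_trans p_gt3.
  by exists (act w (base (Ordinal p0))); split; apply: polygon_hull_vertex.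
(* The lowest vertex of the cell also lies on a face of the preceding belt, by [vertex_inner]. *)
have [d' df e] := face_low q_gt3 p_gt3 vw; rewrite h in e.
set v := (walk (flag_of w) d').1.1 in e.
have vv : valid v by have := walk_valid q_gt3 p_gt3 d' vw; case/andP.
have v0 : v != [::] by apply: contra_eq_neq e => ->.
have [f vf [fv fb]] := vertex_inner q_gt3 p_gt3 vv v0.
have [w2 [mw2 b2 on2]] := exists_polygon vf.
exists (polygon_hull w2); first by exists w2; split => //; rewrite b2 fb; lia.
exists (point v); split; apply/hull_point => //; first by exists d'.
by apply: on2; exists [::].
Qed.

(** Two consecutive belts are carried through the induction. Meeting belt [i.+1] leaves the indices
    [i], [i.+1], [i.+2], and not meeting belt [i] excludes the first two; for [i = 0] the index 0
    never occurs. *)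
Lemma beltE i : belt p q B0 i.+1 = belt_words i.+1.
Proof.
suff [] : belt p q B0 i.+1 = belt_words i.+1 /\ (i != 0%N -> belt p q B0 i = belt_words i) by [].
elim: i => [|i [IH IH']]; first by split => //; apply/funext => C; apply/propext/belt1.
split => //; apply/funext => C; apply/propext.
rewrite -[belt _ _ _ _ C]/([/\ mosaic_cell p q C, meets_belt (belt p q B0 i.+1) C &
   ~ meets_belt (belt p q B0 i) C]).
split=> [[mC m1 m2]|[w [mw -> wi]]].
  have [j [w [mw CE wj]]] := cell_words mC; exists w; split => //.
  rewrite CE in m1 m2.
  have := meets_belt_words (fun _ => IH) m1.
  have := contra_not (belt_words_meets IH' mw) m2.
  have := belt_index_size q (flag_of w).
  have : (0 < belt_index (flag_of w))%N.
    by have [d _ <-] := face_low q_gt3 p_gt3 (flag_of_valid w).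
  case: (i) => [|k]; move: (belt_index _) => n n0 _ h [h1 h2];
    apply/eqP; rewrite eqn_leq h1 /= ltnNge; apply/negP => h3; apply: h; lia.
split => //; first by apply: belt_words_meets => //; left.
by move/(meets_belt_words IH'); rewrite wi; lia.
Qed.

(** One set may come from several words, but the index is the highest level among the vertices it
    contains. *)
Lemma hull_belt_unique w i : belt_words i (polygon_hull w) -> belt_index (flag_of w) = i.
Proof.
move=> [w' [_ hE w'i]].
have le (u u' : seq gen) : polygon_hull u = polygon_hull u' ->
    (belt_index (flag_of u) <= belt_index (flag_of u'))%N.
  move=> e; have [d df <-] := face_high q_gt3 p_gt3 (flag_of_valid u).
  set v := (walk _ d).1.1.
  have vv : valid v by have := walk_valid q_gt3 p_gt3 d (flag_of_valid u); case/andP.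
  have : polygon_hull u (point v) by apply/hull_point => //; exists d.
  by rewrite e => /(hull_bel vv) []->.
by apply/eqP; rewrite -w'i eqn_leq !le.
Qed.

Lemma hull_not_B0 w : polygon_hull w <> [set B0].
Proof.
have [d df hd] := face_high q_gt3 p_gt3 (flag_of_valid w).
set v := (walk _ d).1.1 in hd; move=> e.
have vv : valid v by have := walk_valid q_gt3 p_gt3 d (flag_of_valid w); case/andP.
have : polygon_hull w (point v) by apply/hull_point => //; exists d.
rewrite e /= point_root => /point_inj; rewrite vv => /(_ isT isT) v0.
move: hd; rewrite v0 /=.
by have [d' _ <-] := face_low q_gt3 p_gt3 (flag_of_valid w).
Qed.

(** For [i > 0], a cell of belt [i] bounds the level of the vertex from above and a cell beyond belt
    [i] bounds it from below. Conversely the faces of [vertex_inner] and [vertex_outer] show that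
    the vertex is on the boundary. *)
Lemma level_verticesP i x : level_vertices p q B0 i x <->
  exists v, [/\ valid v, size v = i & x = point v].
Proof.
have vertexE y : mosaic_vertex p q y <-> exists2 v, valid v & y = point v.
  rewrite mosaic_vertexP; split=> [[w ->]|[v /vertex_flag[w _ <-] ->]]; last by exists w.
  exists (flag_of w).1.1; last exact: act_point.
  by have := flag_of_valid w; case/andP.
case: i => [|i].
  split=> [[_ /= ->]|[v [_ /size0nil -> ->]]].
    by exists [::]; split => //; apply: point_root.
  by split; [apply/vertexE; exists [::]|rewrite /= point_root].
split.
  case=> /vertexE[v vv ->] [[C]]; rewrite beltE => -[w [_ -> wi]] /(hull_bel vv) h1.
  case=> D [mD notD]; have [j [w' [mw' DE wj]]] := cell_words mD.
  rewrite DE => /(hull_bel vv) h2; exists v; split => //.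
  have : ~ (belt_index (flag_of w') <= i.+1)%N.
    move=> le; apply: (notD _ le); have := wj; case: (j) => [|j'] e; last first.
      by rewrite e beltE; exists w'.
    by have [d _] := face_low q_gt3 p_gt3 (flag_of_valid w'); rewrite e.
  by move: h1 h2; rewrite wi; lia.
case=> v [vv sv ->]; split; first by apply/vertexE; exists v.
have v0 : v != [::] by rewrite -size_eq0 sv.
split.
  have [f vf [fv fb]] := vertex_inner q_gt3 p_gt3 vv v0.
  have [w [mw wb on]] := exists_polygon vf.
  exists (polygon_hull w); first by rewrite beltE; exists w; split => //; rewrite wb fb sv.
  by apply/hull_point => //; apply: on; exists [::].
have [f vf [fv fb]] := vertex_outer q_gt3 p_gt3 vv.
have [w [mw wb on]] := exists_polygon vf.
exists (polygon_hull w); split => //.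
  case=> [_ /hull_not_B0//|j] ji; rewrite beltE => /hull_belt_unique; rewrite wb fb sv; lia.
by apply/hull_point => //; apply: on; exists [::].
Qed.

Lemma mosaic_edge_point u v : valid u -> valid v -> size v = (size u).+1 ->
  mosaic_edge p q (point u) (point v) <->
  exists2 m, (m < nup q u)%N & v = (m, 0%N) :: u.
Proof.
move=> vu vv sv; rewrite mosaic_edgeP; split.
  case=> w [eu ev].
  have fu : (flag_of w).1.1 = u.
    by apply/esym/point_inj => //; [by have := flag_of_valid w; case/andP|rewrite eu act_point].
  have fv : (step G0 (flag_of w)).1.1 = v.
    have e : flag_of (w ++ [:: G0]) = step G0 (flag_of w) by rewrite flag_of_cat.
    apply/esym/point_inj => //; rewrite -?e.
      by have := flag_of_valid (w ++ [:: G0]); case/andP.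
    by rewrite ev -[S G0 V0]/(act [:: G0] V0) -act_cat act_point.
  have vd : vdart p q (flag_of w).1 by apply: flag_of_valid.
  rewrite -fu -fv; apply: (edge_child q_gt3 p_gt3 vd).
  by rewrite -[edge _]/(step G0 (flag_of w)).1 fv fu.
case=> m mu vE; have [|w fw] := @flag_of_surj (u, updart u m, true).
  by rewrite /vflag /vdart /= vu updart_lt.
exists w; rewrite act_point fw; split => //.
rewrite -[S G0 V0]/(act [:: G0] V0) -act_cat act_point flag_of_cat fw.
by rewrite /walk [foldl _ _ _]/(step G0 _) /step edge_up // vE.
Qed.
End RootedAt.
End Mosaic.

(** * Counting the vertices of a level *)

Section LevelLists.
Local Open Scope nat_scope.
Variables (p q : nat).
Hypotheses (q_gt3 : 3 < q) (p_gt3 : 3 < p).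
Implicit Types (u v : vtx).

Local Notation nup := (nup q).
Local Notation glen := (glen p q).

Definition child_positions u : seq (nat * nat) :=
  [seq (m, l) | m <- iota 0 (nup u), l <- iota 0 (glen u m)].

Fixpoint level_list (i : nat) : seq vtx :=
  if i is i'.+1 then [seq ml :: u | u <- level_list i', ml <- child_positions u]
  else [:: [::]].

Lemma level_listS i :
  level_list i.+1 = [seq ml :: u | u <- level_list i, ml <- child_positions u].
Proof. by []. Qed.

Definition is_A v : bool := if v is (_, 0) :: _ then true else false.

Lemma sumn_const (X : Type) (s : seq X) c : sumn [seq c | _ <- s] = c * size s.
Proof. by elim: s => [|x s IH] /=; rewrite ?muln0 // IH mulnS. Qed.

Lemma mem_child_positions u ml :
  (ml \in child_positions u) = (ml.1 < nup u) && (ml.2 < glen u ml.1).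
Proof.
apply/allpairsPdep/andP => [[m [l [mi li ->]]]|[h1 h2]].
  by move: mi li; rewrite !mem_iota.
by exists ml.1, ml.2; rewrite !mem_iota; split => //; case: (ml).
Qed.

Lemma mem_level_list i v : (v \in level_list i) = valid p q v && (size v == i).
Proof.
elim: i v => [|i IH] v.
  by rewrite inE; case: v => [|a v] //; rewrite andbF.
rewrite level_listS; apply/allpairsPdep/andP => [[u [ml [ui mlu ->]]]|].
  move: ui mlu; rewrite IH mem_child_positions => /andP[vu /eqP su] /andP[h1 h2].
  by split; [case: ml h1 h2 => m l /= -> ->; rewrite vu|rewrite /= su].
case=> vv sv; case: v vv sv => // -[m l] u /and3P[vu mu lu]; rewrite /= eqSS => su.
exists u, (m, l); split => //; last by rewrite mem_child_positions; apply/andP.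
by rewrite IH; apply/andP.
Qed.

Lemma level_list_uniq i : uniq (level_list i).
Proof.
elim: i => //= i IH; apply: allpairs_uniq_dep => //; last first.
  by move=> [u x] [u' x'] _ _ /= [-> ->].
move=> u _; apply: allpairs_uniq_dep; [exact: iota_uniq| by move=> *; exact: iota_uniq|].
by move=> [m l] [m' l'] _ _ /= [-> ->].
Qed.

Lemma count_A_level i :
  count is_A (level_list i.+1) = sumn [seq nup u | u <- level_list i].
Proof.
rewrite level_listS count_flatten -map_comp; congr sumn; apply: eq_map => u /=.
rewrite count_map /child_positions count_flatten -map_comp.
rewrite -[RHS](size_iota 0); elim: (iota _ _) => //= m s ->; rewrite count_map.
have := glen_gt0 q_gt3 p_gt3 u m; case: (glen u m) => // n _ /=.
rewrite [X in 1 + X](_ : _ = 0) ?addn0 ?add1n //.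
by apply/eqP; rewrite -leqn0 leqNgt -has_count; apply/hasPn => l; rewrite mem_iota; case: l.
Qed.

(** Only the last group is one shorter than [p - 2]. *)
Lemma size_child_positions u : u != [::] ->
  (size (child_positions u)).+1 = (p - 2) * nup u.
Proof.
move=> u0; rewrite size_allpairs_dep; under eq_map do rewrite size_iota.
have := nup_gt0 q_gt3 u; rewrite /glen; case: nilP => [/eqP/(negP u0)//|_ /=].
case: (nup u) => // n _; have -> : iota 0 n.+1 = iota 0 n ++ [:: n] by rewrite -(addn1 n) iotaD.
rewrite map_cat sumn_cat /= addn0 ltnn.
have -> : [seq (if m.+1 < n.+1 then p - 2 else p - 3) | m <- iota 0 n] =
    [seq p - 2 | _ <- iota 0 n].
  by apply/eq_in_map => m; rewrite mem_iota /= ltnS => ->.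
by rewrite sumn_const size_iota mulnS; lia.
Qed.

Lemma size_level1 : size (level_list 1) = q * (p - 2).
Proof.
rewrite /= cats0 size_map size_allpairs_dep; under eq_map do rewrite size_iota.
by rewrite /glen /= sumn_const size_iota mulnC.
Qed.

Lemma count_A_level1 : count is_A (level_list 1) = q.
Proof. by rewrite count_A_level /= addn0. Qed.

Lemma level_neq0 i u : u \in level_list i.+1 -> u != [::].
Proof. by rewrite mem_level_list => /andP[_]; case: u. Qed.

(** Summation of [size_child_positions] over a level, whose upward edges correspond to the type A
    vertices of the next. *)
Lemma size_levelS i : size (level_list i.+2) + size (level_list i.+1) =
  (p - 2) * count is_A (level_list i.+2).
Proof.
rewrite count_A_level [level_list i.+2]level_listS.
rewrite size_allpairs_dep; have := @level_neq0 i; elim: (level_list i.+1) => [|u s IH] h /=.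
  by rewrite muln0.
rewrite mulnDr -IH => [|v vs]; last by apply: h; rewrite inE vs orbT.
by rewrite -(size_child_positions (h _ (mem_head _ _))); lia.
Qed.

Lemma count_A_levelS i : count is_A (level_list i.+2) =
  (q - 3) * count is_A (level_list i.+1) + (q - 2) * count (predC is_A) (level_list i.+1).
Proof.
rewrite count_A_level; have := @level_neq0 i; elim: (level_list i.+1) => [|u s IH] h /=.
  by rewrite !muln0.
rewrite IH => [|v vs]; last by apply: h; rewrite inE vs orbT.
by have := h u (mem_head _ _); case: u {h} => [|[m [|l]] u] //= _; lia.
Qed.
End LevelLists.

(** * The trees and the numbers of type A and type B vertices *)

Section Trees.
Variables (R : realType) (p q : nat).
Hypotheses (q_gt3 : (3 < q)%N) (p_gt3 : (3 < p)%N) (pq : (4 < (p - 2) * (q - 2))%N).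
Variables (w0 : seq gen) (T : nat -> set ('rV[R]_3 * 'rV[R]_3)).
Let B0 := wact (@lor R) (root R p q) w0 (vertex0 R p q).
Hypothesis tT : tree_system p q B0 T.
Implicit Types (u v : vtx).

Local Notation valid := (valid p q).
Local Notation point := (@point R p q w0).
Local Notation level_list := (level_list p q).

Let pt_inj := @point_inj R p q q_gt3 p_gt3 pq w0.
Let levelP := @level_verticesP R p q q_gt3 p_gt3 pq w0.

Definition child_edges (i : nat) : seq ('rV[R]_3 * 'rV[R]_3) :=
  [seq (point (behead v), point v) | v <- level_list i.+1 & is_A v].

Lemma child_edgesP i x y : (x, y) \in child_edges i <->
  exists u m, [/\ valid u, size u = i, (m < nup q u)%N, x = point u & y = point ((m, 0%N) :: u)].
Proof.
split=> [/mapP[v]|[u [m [vu su mu -> ->]]]].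
  rewrite mem_filter mem_level_list => /and3P[].
  case: v => // -[m [|//]] u _ /and3P[vu mu _] /= /eqP[su] [-> ->].
  by exists u, m.
apply/mapP; exists ((m, 0%N) :: u) => //.
by rewrite mem_filter mem_level_list /= vu mu su eqxx glen_gt0.
Qed.

Lemma child_edges_admissible i : admissible_edges p q B0 i [set` child_edges i].
Proof.
have vch u m : valid u -> (m < nup q u)%N -> valid ((m, 0%N) :: u).
  by move=> vu mu; apply/and3P; split => //; apply: glen_gt0.
split.
- move=> x y /child_edgesP[u [m [vu su mu -> ->]]]; split.
  + by apply/levelP; exists u.
  + by apply/levelP; exists ((m, 0%N) :: u); rewrite vch //= su.
  + have [_] := @mosaic_edge_point R p q q_gt3 p_gt3 pq w0 _ _ vu (vch _ _ vu mu) (erefl _).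
    by apply; exists m.
- move=> x x' y /child_edgesP[u [m [vu su mu -> ->]]] /child_edgesP[u' [m' [vu' su' mu' -> e]]].
  by have [_ ->] := pt_inj (vch _ _ vu mu) (vch _ _ vu' mu') e.
- move=> x /levelP[u [vu su ->]]; exists (point ((0%N, 0%N) :: u)).
  by apply/child_edgesP; exists u, 0%N; split => //; apply: nup_gt0.
Qed.

(** Every mosaic edge between the two levels is a child edge, so [T i] is contained in a finite set
    that is itself admissible; maximal cardinality gives equality. *)
Lemma tree_edges i : T i = [set` child_edges i].
Proof.
have [[Ti _ _] Tmax] := tT i.
have sub : T i `<=` [set` child_edges i].
  move=> [x y] /Ti[/levelP[u [vu su ->]] /levelP[v [vv sv ->]]].
  have sz : size v = (size u).+1 by rewrite su.
  case/(@mosaic_edge_point R p q q_gt3 p_gt3 pq w0 _ _ vu vv sz) => m mu vE.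
  by apply/child_edgesP; exists u, m; rewrite -vE.
have fF : finite_set [set` child_edges i] by apply: finite_seq.
have fT : finite_set (T i) := sub_finite_set sub fF.
have [n Tn] := (finite_setP _).1 fT.
have subf : (fset_set (T i) `<=` fset_set [set` child_edges i])%fset.
  by rewrite -fset_set_sub.
apply: fset_set_inj => //; apply/eqP; rewrite eqEfcard subf /=.
rewrite (card_fset_set Tn); apply: geq_card_fset_set.
by have /card_eqPle[Tn' _] := Tn; apply: card_le_trans (Tmax _ (child_edges_admissible i)) Tn'.
Qed.

Lemma has_parentP i v : valid v -> size v = i -> has_parent T i (point v) <-> is_A v.
Proof.
move=> vv; case: i => [/size0nil -> //|i sv]; rewrite /= tree_edges; split.
  case=> x /child_edgesP[u [m [vu su mu _ e]]].
  suff -> : v = (m, 0%N) :: u by [].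
  by apply: pt_inj => //; apply/and3P; split => //; apply: glen_gt0.
case: v vv sv => // -[m [|//]] u /and3P[vu mu _] [su] _.
by exists (point u); apply/child_edgesP; exists u, m.
Qed.

Lemma card_points i (P : pred vtx) (A : set 'rV[R]_3) :
  (forall y, A y <-> exists v, [/\ valid v, size v = i, P v & y = point v]) ->
  #|` fset_set A| = count P (level_list i).
Proof.
move=> AP; rewrite -size_filter.
(* This also shows that [A] is finite, so that [fset_set] does not take its default value. *)
have -> : A = [set` [fset y in [seq point v | v <- level_list i & P v]]%fset].
  apply/seteqP; split=> y /=.
    move=> /AP[v [vv sv Pv ->]]; rewrite !inE; apply: map_f.
    by rewrite mem_filter Pv mem_level_list vv sv eqxx.
  rewrite !inE => /mapP[v]; rewrite mem_filter mem_level_list => /and3P[Pv vv /eqP sv] ->.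
  by apply/AP; exists v.
rewrite set_fsetK card_fseq undup_id ?size_map //.
rewrite map_inj_in_uniq ?filter_uniq ?level_list_uniq // => u v.
rewrite !mem_filter !mem_level_list => /and3P[_ vu _] /and3P[_ vv _].
exact: pt_inj.
Qed.

Lemma num_A_count i : num_A p q B0 T i = count is_A (level_list i).
Proof.
apply: card_points => y; split=> [[/levelP[v [vv sv ->]] /(has_parentP vv sv)]|].
  by exists v.
by case=> v [vv sv Av ->]; split; [apply/levelP; exists v|apply/has_parentP].
Qed.

Lemma num_B_count i : num_B p q B0 T i = count (predC is_A) (level_list i).
Proof.
apply: card_points => y; split=> [[/levelP[v [vv sv ->]]]|].
  by rewrite (has_parentP vv sv) => /negP; exists v.
case=> v [vv sv /negP Av ->]; split; first by apply/levelP; exists v.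
by rewrite (has_parentP vv sv).
Qed.

Lemma num_AB i : (num_A p q B0 T i + num_B p q B0 T i = size (level_list i))%N.
Proof. by rewrite num_A_count num_B_count count_predC. Qed.

Lemma num_A_1 : num_A p q B0 T 1 = q.
Proof. by rewrite num_A_count count_A_level1. Qed.

Lemma num_B_1 : num_B p q B0 T 1 = (q * (p - 3))%N.
Proof. by have := num_AB 1; rewrite num_A_1 size_level1; move: p_gt3; nia. Qed.

Lemma num_A_rec i : num_A p q B0 T i.+2 =
  ((q - 3) * num_A p q B0 T i.+1 + (q - 2) * num_B p q B0 T i.+1)%N.
Proof. by rewrite !num_A_count num_B_count count_A_levelS. Qed.

Lemma num_B_rec i :
  (num_B p q B0 T i.+2 + (num_A p q B0 T i.+1 + num_B p q B0 T i.+1) =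
   (p - 3) * num_A p q B0 T i.+2)%N.
Proof.
have := size_levelS q_gt3 p_gt3 i; rewrite -!num_AB -num_A_count.
by move: p_gt3; nia.
Qed.
End Trees.

(** * The limits *)

Lemma char_roots (R : realType) (c : R) : 2 < c ->
  let z1 := (c + Num.sqrt (c ^+ 2 - 4)) / 2 in
  let z2 := (c - Num.sqrt (c ^+ 2 - 4)) / 2 in
  [/\ z1 + z2 = c, z1 * z2 = 1 & 1 < z1].
Proof.
move=> c2 z1 z2; have d0 : 0 < c ^+ 2 - 4 by rewrite expr2; nra.
have : 0 < Num.sqrt (c ^+ 2 - 4) by rewrite sqrtr_gt0.
have := sqr_sqrtr (ltW d0); rewrite /z1 /z2; move: (Num.sqrt _) => s s2 s0; split.
- by field.
- have -> : (c + s) / 2 * ((c - s) / 2) = (c ^+ 2 - s ^+ 2) / 4 by field.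
  by rewrite s2; field.
- by lra.
Qed.

(** * Asymptotics of a second-order recurrence with reciprocal roots *)

Section LinearRecurrence.
Variables (R : realType) (c z1 z2 : R).
Hypotheses (char_root_add : z1 + z2 = c) (char_root_mul : z1 * z2 = 1).
Hypothesis char_root_gt1 : 1 < z1.

Let z1_gt0 : 0 < z1. Proof. exact: lt_trans char_root_gt1. Qed.

Lemma char_root2_gt0 : 0 < z2.
Proof. by rewrite -(pmulr_rgt0 z2 z1_gt0) char_root_mul. Qed.

Lemma char_root2_lt1 : z2 < 1.
Proof. by rewrite -(ltr_pM2l z1_gt0) char_root_mul mulr1 char_root_gt1. Qed.

Let z1_neq0 : z1 != 0. Proof. by rewrite gt_eqF. Qed.
Let z2_neq0 : z2 != 0. Proof. by rewrite gt_eqF ?char_root2_gt0. Qed.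
Let z12_neq0 : z1 - z2 != 0.
Proof. by rewrite gt_eqF // subr_gt0 (lt_trans char_root2_lt1) ?char_root_gt1. Qed.

Section Sequence.
Variable x : nat -> R.
Hypothesis x_rec : forall i, x i.+3 = c * x i.+2 - x i.+1.

Let g1 := (x 2%N - z2 * x 1%N) / (z1 * (z1 - z2)).
Let g2 := (z1 * x 1%N - x 2%N) / (z2 * (z1 - z2)).

(** The coefficients fit indices 1 and 2. Index 0 is left out because [x_rec] relates only terms
    from index 1 on. *)
Lemma recurrence_closed i : x i.+1 = g1 * z1 ^+ i.+1 + g2 * z2 ^+ i.+1.
Proof.
suff [] : x i.+1 = g1 * z1 ^+ i.+1 + g2 * z2 ^+ i.+1 /\
          x i.+2 = g1 * z1 ^+ i.+2 + g2 * z2 ^+ i.+2 by [].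
elim: i => [|i [IH1 IH2]].
  split; rewrite /g1 /g2; field; by rewrite z1_neq0 z2_neq0 z12_neq0.
split=> //; rewrite x_rec IH1 IH2 -char_root_add.
have e1 : z1 ^+ i.+3 = (z1 + z2) * z1 ^+ i.+2 - z1 * z2 * z1 ^+ i.+1 by rewrite !exprS; ring.
have e2 : z2 ^+ i.+3 = (z1 + z2) * z2 ^+ i.+2 - z1 * z2 * z2 ^+ i.+1 by rewrite !exprS; ring.
by rewrite e1 e2 char_root_mul; ring.
Qed.

Let cvg_geom (u : R) : 0 < u -> u < 1 -> (fun i => u ^+ i.+1) @ \oo --> (0 : R).
Proof.
move=> u0 u1; rewrite (cvg_shiftS (fun i => u ^+ i)).
by apply: cvg_expr; rewrite gtr0_norm.
Qed.

Lemma recurrence_cvg : (fun i => x i / z1 ^+ i) @ \oo --> g1.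
Proof.
rewrite -cvg_shiftS.
have -> : (fun i => x i.+1 / z1 ^+ i.+1) = (fun i => g1 + g2 * (z2 / z1) ^+ i.+1).
  apply/funext => i; rewrite recurrence_closed mulrDl mulfK ?expf_neq0 //.
  by rewrite exprMn exprVn mulrA.
suff : (fun i => g1 + g2 * (z2 / z1) ^+ i.+1) @ \oo --> g1 + g2 * 0.
  by rewrite mulr0 addr0.
apply: cvgD; first exact: cvg_cst.
apply: cvgMr; apply: cvg_geom; first by rewrite divr_gt0 ?char_root2_gt0.
by rewrite ltr_pdivrMr // mul1r (lt_trans char_root2_lt1) ?char_root_gt1.
Qed.

Lemma recurrence_sum_cvg :
  (fun i => (\sum_(0 <= j < i.+1) x j) / z1 ^+ i) @ \oo --> g1 * z1 / (z1 - 1).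
Proof.
have z11 : z1 - 1 != 0 by rewrite gt_eqF // subr_gt0 char_root_gt1.
have z21 : z2 - 1 != 0 by rewrite lt_eqF // subr_lt0 char_root2_lt1.
(* The constant collects the free term [x 0] and the lower ends of the two geometric sums. *)
pose k := x 0%N - g1 * z1 / (z1 - 1) - g2 * z2 / (z2 - 1).
have sumE i : \sum_(0 <= j < i.+2) x j =
    g1 * z1 / (z1 - 1) * z1 ^+ i.+1 + k + g2 * z2 / (z2 - 1) * z2 ^+ i.+1.
  elim: i => [|i IH].
    rewrite !big_nat_recr //= big_geq // recurrence_closed /k add0r !expr1.
    by field; rewrite z11 z21.
  rewrite big_nat_recr //= IH recurrence_closed (exprS z1 i.+1) (exprS z2 i.+1).
  by field; rewrite z11 z21.
rewrite -cvg_shiftS.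
have -> : (fun i => (\sum_(0 <= j < i.+2) x j) / z1 ^+ i.+1) =
    (fun i => g1 * z1 / (z1 - 1) + k * z2 ^+ i.+1 + g2 * z2 / (z2 - 1) * (z2 * z2) ^+ i.+1).
  apply/funext => i; rewrite sumE.
  have -> : z2 = z1^-1 by rewrite -[z2](mulKf z1_neq0) char_root_mul mulr1.
  by rewrite !mulrDl mulfK ?expf_neq0 // exprMn !exprVn -!mulrA.
set l1 := g1 * z1 / (z1 - 1); set l2 := g2 * z2 / (z2 - 1).
suff : (fun i => l1 + k * z2 ^+ i.+1 + l2 * (z2 * z2) ^+ i.+1) @ \oo --> l1 + k * 0 + l2 * 0.
  by rewrite !mulr0 !addr0.
have h0 := char_root2_gt0; have h1 := char_root2_lt1.
apply: cvgD.
  by apply: cvgD; [exact: cvg_cst|apply: cvgMr; apply: cvg_geom].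
by apply: cvgMr; apply: cvg_geom; nra.
Qed.
End Sequence.

Let ratio (x y : nat -> R) (lx ly : R) : ly != 0 ->
  (fun i => x i / z1 ^+ i) @ \oo --> lx -> (fun i => y i / z1 ^+ i) @ \oo --> ly ->
  (fun i => x i / y i) @ \oo --> lx / ly.
Proof.
move=> ly0 xl yl.
have -> : (fun i => x i / y i) = (fun i => (x i / z1 ^+ i) * (y i / z1 ^+ i)^-1).
  (* The identity includes indices with [y i = 0], such as [a 0], since the inverse of 0 is 0. *)
  apply/funext => i; rewrite invf_div mulrA mulfVK ?expf_neq0 //.
by apply: cvgM => //; apply: cvgV.
Qed.

Variables (a b : nat -> R).
Hypothesis a_rec : forall i, a i.+3 = c * a i.+2 - a i.+1.
Hypothesis b_rec : forall i, b i.+3 = c * b i.+2 - b i.+1.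
Let ga1 := (a 2%N - z2 * a 1%N) / (z1 * (z1 - z2)).
Let gb1 := (b 2%N - z2 * b 1%N) / (z1 * (z1 - z2)).
Hypotheses (a1_gt0 : 0 < a 1%N) (a21 : a 1%N <= a 2%N).
Hypotheses (b1_gt0 : 0 < b 1%N) (b21 : b 1%N <= b 2%N).

(** As [z2 < 1], growth from index 1 to 2 makes the leading coefficient positive, so the limits have
    nonzero denominators. *)
Let lead_gt0 (x : nat -> R) : 0 < x 1%N -> x 1%N <= x 2%N ->
  0 < (x 2%N - z2 * x 1%N) / (z1 * (z1 - z2)).
Proof.
move=> x1 x21; rewrite divr_gt0 // ?mulr_gt0 //; last first.
  by rewrite subr_gt0 (lt_trans char_root2_lt1) ?char_root_gt1.
by have := char_root2_lt1; nra.
Qed.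

Lemma recurrence_limits :
  [/\ (fun i => b i / \sum_(0 <= j < i.+1) b j) @ \oo --> (z1 - 1) / z1,
      (fun i => b i / a i) @ \oo --> gb1 / ga1 &
      (fun i => b i / (a i + b i)) @ \oo --> (gb1 / ga1) / (1 + gb1 / ga1)].
Proof.
have ga0 : 0 < ga1 by apply: lead_gt0.
have gb0 : 0 < gb1 by apply: lead_gt0.
have z11 : 0 < z1 - 1 by rewrite subr_gt0 char_root_gt1.
have al := recurrence_cvg a_rec; have bl := recurrence_cvg b_rec.
split.
- have -> : (z1 - 1) / z1 = gb1 / (gb1 * z1 / (z1 - 1)).
    by field; rewrite !gt_eqF.
  apply: ratio bl (recurrence_sum_cvg b_rec).
  by rewrite gt_eqF // divr_gt0 // mulr_gt0.
- by apply: ratio => //; rewrite gt_eqF.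
- have -> : gb1 / ga1 / (1 + gb1 / ga1) = gb1 / (ga1 + gb1).
    move: ga0 gb0; move: (ga1) (gb1) => u v u0 v0.
    by field; apply/andP; split; rewrite gt_eqF // addr_gt0.
  apply: ratio => //; first by rewrite gt_eqF // addr_gt0.
  under eq_fun do rewrite mulrDl.
  exact: cvgD.
Qed.
End LinearRecurrence.

Theorem theorem2 (R : realType) (p q : nat) (B0 : 'rV[R]_3)
    (T : nat -> set ('rV[R]_3 * 'rV[R]_3)) :
  (3 < p)%N -> (3 < q)%N -> (4 < (p - 2) * (q - 2))%N ->
  mosaic_vertex p q B0 ->
  tree_system p q B0 T ->
  let a : nat -> R := fun i => (num_A p q B0 T i)%:R in
  let b : nat -> R := fun i => (num_B p q B0 T i)%:R in
  let c : R := (p%:R - 2) * (q%:R - 2) - 2 in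
  let z1 : R := (c + Num.sqrt (c ^+ 2 - 4)) / 2 in
  let z2 : R := (c - Num.sqrt (c ^+ 2 - 4)) / 2 in
  let ga1 : R := (a 2%N - z2 * a 1%N) / (z1 * (z1 - z2)) in
  let gb1 : R := (b 2%N - z2 * b 1%N) / (z1 * (z1 - z2)) in
  let L : R := gb1 / ga1 in
  let K : R := L / (1 + L) in
  [/\ (fun i : nat => b i / \sum_(0 <= j < i.+1) b j) @ \oo --> (z1 - 1) / z1,
      (fun i : nat => b i / a i) @ \oo --> L &
      (fun i : nat => b i / (a i + b i)) @ \oo --> K].
Proof.
move=> p_gt3 q_gt3 pq /(mosaic_vertexP q_gt3 p_gt3 pq)[w0 ->] tT a b c.
have P4 : 4 <= p%:R :> R by rewrite ler_nat.
have Q4 : 4 <= q%:R :> R by rewrite ler_nat.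
have c_gt2 : 2 < c.
  have : (4%:R : R) < ((p - 2) * (q - 2))%:R by rewrite ltr_nat.
  by rewrite natrM !natrB ?(ltn_trans _ p_gt3) ?(ltn_trans _ q_gt3) // /c; lra.
have a1 : a 1%N = q%:R by rewrite /a (num_A_1 q_gt3 p_gt3 pq tT).
have b1 : b 1%N = q%:R * (p%:R - 3).
  by rewrite /b (num_B_1 q_gt3 p_gt3 pq tT) natrM natrB // ltnW.
have a_rec i : a i.+2 = (q%:R - 3) * a i.+1 + (q%:R - 2) * b i.+1.
  rewrite /a /b (num_A_rec q_gt3 p_gt3 pq tT) natrD !natrM !natrB //.
    exact: ltnW (ltnW _).
  exact: ltnW.
have b_rec i : b i.+2 = (p%:R - 3) * a i.+2 - (a i.+1 + b i.+1).
  apply/eqP; rewrite eq_sym subr_eq eq_sym /a /b -!natrD.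
  by rewrite (num_B_rec q_gt3 p_gt3 pq tT) natrM natrB // ltnW.
have [z_add z_mul z1_gt1] := char_roots c_gt2.
apply: (recurrence_limits z_add z_mul z1_gt1).
- by move=> i; rewrite !(a_rec, b_rec) /c; ring.
- by move=> i; rewrite !(a_rec, b_rec) /c; ring.
- by rewrite a1; lra.
- rewrite a_rec a1 b1 -subr_ge0.
  have -> : (q%:R - 3) * q%:R + (q%:R - 2) * (q%:R * (p%:R - 3)) - q%:R =
    q%:R * ((q%:R - 4) + (q%:R - 2) * (p%:R - 3)) :> R by ring.
  apply: mulr_ge0; first by lra.
  by apply: addr_ge0; [|apply: mulr_ge0]; lra.
- by rewrite b1 mulr_gt0 //; lra.
- rewrite b_rec a_rec a1 b1 -subr_ge0.
  (* Written in terms of [p - 4] and [q - 4], every summand is visibly nonnegative. *)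
  have -> : (p%:R - 3) * ((q%:R - 3) * q%:R + (q%:R - 2) * (q%:R * (p%:R - 3))) -
      (q%:R + q%:R * (p%:R - 3)) - q%:R * (p%:R - 3) =
    q%:R * ((2 * (p%:R - 3) + 1) * (p%:R - 4) +
            (q%:R - 4) * ((p%:R - 3) * (p%:R - 2))) :> R by ring.
  apply: mulr_ge0; first by lra.
  by apply: addr_ge0; apply: mulr_ge0; try apply: mulr_ge0; lra.
Qed.
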